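(* Let $n \geq 2$ be an integer, let $r,s$ be nonnegative integers with $r + 2s = n$, and let $S$ be a finite set of primes. Then there exist infinitely many monic irreducible polynomials $P(x)$ of degree $n$ with integer coefficients having exactly $r$ real roots, such that $\Delta(P)$ is squarefree and not divisible by any of the primes in $S$. More precisely, there is a constant $c>0$ (depending on $n$ and $S$) such that for all $N$ the number of distinct squarefree discriminants $\Delta(P)$ of such polynomials lying in the range $[-N, N]$ is at least $cN^{1/(n-1)}$.
   Context: For a monic polynomial $P(x)$ of degree $n$ with integer coefficients, factored as $P(x) = (x-r_1)\cdots(x-r_n)$ over an algebraically closed field, the discriminant is the integer $\Delta(P) = \prod_{1 \leq i < j \leq n} (r_i - r_j)^2$.
   Formalization: The bound cN^{1/(n-1)} is proved for all sufficiently large N instead of for all N (it fails at N = 1, where no such discriminant exists), and c may also depend on r (finitely many values, so take the minimum). *)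

(* Defs.v *)
From HB Require Import structures.
From mathcomp Require Import all_boot all_order all_algebra all_field.
Set Implicit Arguments. Unset Strict Implicit. Unset Printing Implicit Defensive.
Import Order.TTheory GRing.Theory Num.Theory.
Local Open Scope ring_scope.

Definition rootsC (p : {poly int}) : seq algC :=
  sval (closed_field_poly_normal (map_poly (intr : int -> algC) p)).

Definition discC (p : {poly int}) : algC :=
  let rs := rootsC p in
  \prod_(i < size rs) \prod_(j < size rs | (i < j)%N) (rs`_i - rs`_j) ^+ 2.

Definition nreal_roots (p : {poly int}) : nat :=
  count (fun z : algC => z \is Num.real) (rootsC p).

Definition sqfree_int (d : int) : Prop :=
  d != 0 /\ forall p : nat, prime p -> ~~ (p * p %| `|d|)%N.

Definition good_poly (n r : nat) (S : seq nat) (P : {poly int}) : Prop :=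
  [/\ P \is monic, size P = n.+1,
      irreducible_poly (map_poly (intr : int -> rat) P),
      nreal_roots P = r &
      exists d : int, discC P = d%:~R /\ sqfree_int d /\
                      forall p, p \in S -> ~~ (p %| `|d|)%N].

(* Main.v *)
Require Import Defs.
From mathcomp Require Import all_boot all_order all_algebra all_field.
From mathcomp Require Import cyclic zify ring lra.
From mathcomp Require polyrcf.
Import Order.TTheory GRing.Theory Num.Theory.
Local Open Scope ring_scope.
Set Implicit Arguments. Unset Strict Implicit. Unset Printing Implicit Defensive.

(** The idea, due to Kedlaya, is to choose P monic of degree n with integral coefficients,
    P(0) = 0 and P' = n (X - a_1) ... (X - a_(n-1)) with all a_i rational. For every integer T,
    the polynomial T^n P(X/T) + c has critical points T a_i, hence its discriminant is
    +- n^n prod (T^n P(a_i) + c): a product of linear forms in c, whose squarefree values can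
    be sieved unconditionally.
    The a_i are positive and grow so fast that the critical values P(a_i) alternate in sign and
    grow in absolute value; taking c / T^n between two consecutive |P(a_i)| then produces any
    prescribed number of real roots.  All a_i but the last are multiples of n!, and the last is
    m/n with m = -1 modulo n and n - 1 dividing m; this makes P integral and the discriminant
    prime to n whenever c is.  Every other prime that could divide two of the linear forms, or
    that is small, or in S, is made to divide T, so that it does not divide the discriminant
    either.  One prime l = 1 modulo n also divides T, and c = -g modulo l for a primitive root
    g: modulo l the polynomial is X^n - g, which is irreducible.
    With T running through powers of a fixed integer, c ranges over about T^n values and the
    discriminants have size about T^(n(n-1)). *)

Local Notation toC := (intr : int -> algC).
Local Notation toQ := (intr : int -> rat).

(** * Counting real roots *)

(* Here [m] is the number of real roots and [H i] the number of those above the [i]-th of the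
   [N] critical points: it drops by at most one from a critical point to the next, and its
   parity gives the sign of the critical value. *)
Lemma upper_counts_determined (N s m : nat) (H : nat -> nat) :
  (0 < N)%N -> (2 * s <= N.+1)%N ->
  (H 0 <= m <= (H 0).+1)%N ->
  (forall i, (i.+1 < N)%N -> (H i.+1 <= H i <= (H i.+1).+1)%N) ->
  (H N.-1 <= 1)%N ->
  (forall i, (i < 2 * s)%N -> (i < N)%N -> ~~ odd (H i)) ->
  (forall i, (2 * s <= i)%N -> (i < N)%N -> odd (H i) = odd (N - i)) ->
  odd m = odd N.+1 -> m = (N.+1 - 2 * s)%N.
Proof.
move=> N0 sN m0 Hs HN Hev Hod om.
have flat i : (i < N)%N -> (i < 2 * s)%N -> H 0%N = H i.
  elim: i => // i IH iN is2.
  have := Hs i iN; have := Hev i (ltnW is2) (ltnW iN); have := Hev _ is2 iN.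
  rewrite IH; lia.
have tail d : (d < N)%N -> (2 * s <= N.-1 - d)%N -> H (N.-1 - d)%N = d.+1.
  elim: d => [|d IH] dN sd.
    have := Hod (N.-1 - 0)%N; rewrite subn0; have := HN; lia.
  have E : (N.-1 - d = (N.-1 - d.+1).+1)%N by lia.
  have := Hs (N.-1 - d.+1)%N; rewrite -E IH; try lia.
  have := Hod (N.-1 - d.+1)%N sd; lia.
case: (posnP s) => [s0|s0].
  have := tail N.-1; rewrite subnn; lia.
case: (leqP (2 * s).+1 N) => sN'.
  have := tail (N.-1 - 2 * s)%N.
  have -> : (N.-1 - (N.-1 - 2 * s) = 2 * s)%N by lia.
  move=> T; have {}T : H (2 * s)%N = (N.-1 - 2 * s).+1 by apply: T; lia.
  have := Hs (2 * s).-1; rewrite prednK; last by lia.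
  move=> S; have {}S : (H (2 * s) <= H (2 * s).-1 <= (H (2 * s)).+1)%N by apply: S.
  have F : H 0%N = H (2 * s).-1 by apply: flat; lia.
  have V : ~~ odd (H (2 * s).-1) by apply: Hev; lia.
  lia.
have F : H 0%N = H N.-1 by apply: flat; lia.
have V : ~~ odd (H N.-1) by apply: Hev; lia.
lia.
Qed.

Section RealRoots.
Variable R : rcfType.
Implicit Types (rs : seq R) (p q : {poly R}) (x y : R).

Lemma prod_sub_sign rs x : x \notin rs ->
  0 < (-1) ^+ count (> x) rs * \prod_(z <- rs) (x - z).
Proof.
elim: rs => [|z rs IH]; first by rewrite big_nil mulr1.
rewrite inE negb_or big_cons /= => /andP[xz /IH {}IH].
set P := \prod_(j <- _) _ in IH *; set k := count _ _ in IH *.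
case: (ltgtP x z) xz => //= h _; rewrite ?add0n ?add1n ?exprS.
  have -> : -1 * (-1) ^+ k * ((x - z) * P) = (z - x) * ((-1) ^+ k * P) by ring.
  by rewrite mulr_gt0 // subr_gt0.
by rewrite mulrCA mulr_gt0 // subr_gt0.
Qed.

(** Rolle's theorem: two roots in the convex set [I] would enclose a critical point, which again
    lies in [I]. *)
Lemma uniq_between_critical (p q : {poly R}) rs (I : pred R) :
  p = \prod_(z <- rs) ('X - z%:P) * q -> uniq rs ->
  (forall u c v, I u -> I v -> u < c -> c < v -> I c) ->
  (forall c, I c -> ~~ root p^`() c) ->
  (count I rs <= 1)%N.
Proof.
move=> pE urs cvx noc; rewrite -size_filter.
have us : uniq [seq z <- rs | I z] by apply: filter_uniq.
case E : (filter _ _) us => [|a [|b l]] //= /andP[].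
rewrite inE negb_or => /andP[ab _] _.
have mem c : c \in [:: a, b & l] -> I c /\ p.[c] = 0.
  rewrite -E mem_filter => /andP[Ic cr]; split=> //.
  have r0 : root (\prod_(z <- rs) ('X - z%:P)) c by rewrite root_prod_XsubC.
  by rewrite pE hornerM (rootP r0) mul0r.
have [Ia pa] := mem a (mem_head _ _).
have [|Ib pb] := mem b; first by rewrite !inE eqxx orbT.
have main u v : I u -> I v -> u < v -> p.[u] = 0 -> p.[v] = 0 -> False.
  move=> Iu Iv uv pu pv.
  have [c] := polyrcf.poly_rolle uv (etrans pu (esym pv)).
  rewrite in_itv /= => /andP[uc cv] /rootP rc.
  by have := noc c (cvx u c v Iu Iv uc cv); rewrite rc.
by case: (ltgtP a b) ab => // ab _; [case: (main a b)|case: (main b a)].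
Qed.

(** Here [rs] lists the real roots with multiplicity and [q] is the factor without real roots. The
    signs of the critical values and Rolle's theorem supply the hypotheses of
    [upper_counts_determined]. *)
Lemma count_real_roots (p q : {poly R}) rs (a : nat -> R) (N s : nat) (c : R) :
  (0 < N)%N -> (2 * s <= N.+1)%N -> odd (size rs) = odd N.+1 ->
  p = \prod_(z <- rs) ('X - z%:P) * q -> (forall x, 0 < q.[x]) ->
  c != 0 -> p^`() = c *: \prod_(i < N) ('X - (a i)%:P) ->
  (forall i j, (i < j < N)%N -> a i < a j) ->
  (forall i, (i < 2 * s)%N -> (i < N)%N -> 0 < p.[a i]) ->
  (forall i, (2 * s <= i)%N -> (i < N)%N -> 0 < (-1) ^+ (N - i) * p.[a i]) ->
  size rs = (N.+1 - 2 * s)%N.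
Proof.
move=> N0 sN odd_rs pE q0 c0 dp amono sgn1 sgn2.
have pev x : p.[x] = \prod_(z <- rs) (x - z) * q.[x].
  rewrite pE hornerM horner_prod; congr (_ * _).
  by apply: eq_bigr => z _; rewrite hornerXsubC.
have pnz i : (i < N)%N -> p.[a i] != 0.
  move=> iN; case: (ltnP i (2 * s)) => h; first by rewrite gt_eqF // sgn1.
  have := sgn2 i h iN; apply: contraTneq => ->; by rewrite mulr0 ltxx.
have anr i : (i < N)%N -> a i \notin rs.
  move=> iN; apply: contraNN (pnz i iN) => ar; rewrite pev (big_rem _ ar) /=.
  by rewrite subrr !mul0r.
have dproot x : root p^`() x -> exists2 i, (i < N)%N & x = a i.
  rewrite dp rootZ // /root horner_prod prodf_seq_eq0 => /hasP[i _] /=.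
  rewrite hornerXsubC subr_eq0 => /eqP ->; by exists i.
(* A multiple root would be a critical point, but no critical value vanishes. *)
have urs : uniq rs.
  apply: count_mem_uniq => x; case: (boolP (x \in rs)) => [xr|/count_memPn //].
  apply/eqP; rewrite eqn_leq -has_count has_pred1 xr andbT leqNgt; apply/negP => c2.
  have xr2 : x \in rem x rs.
    by rewrite -has_pred1 has_count count_rem xr /= eqxx subn_gt0.
  have /dproot[i iN xi] : root p^`() x.
    have E : \prod_(z <- rs) ('X - z%:P) =
        ('X - x%:P) * (('X - x%:P) * \prod_(y <- rem x (rem x rs)) ('X - y%:P)).
      by rewrite (big_rem _ xr) (big_rem _ xr2).
    rewrite pE E; set r := \prod_(y <- _) _.
    have hx : ('X - x%:P).[x] = 0 by rewrite hornerXsubC subrr.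
    by rewrite /root !derivM derivXsubC !(hx, hornerM, hornerD); apply/eqP; ring.
  by have := anr i iN; rewrite -xi xr.
pose H i := count (> a i) rs.
have par i : (i < N)%N -> 0 < (-1) ^+ H i * p.[a i].
  by move=> iN; rewrite pev mulrA mulr_gt0 ?prod_sub_sign ?anr.
have sub (P1 P2 : pred R) : (forall z, P1 z -> P2 z) -> (count P1 rs <= count P2 rs)%N.
  by move=> h; apply: sub_count.
have split_le (P1 P2 P3 : pred R) :
    (forall z, z \in rs -> P1 z -> P2 z || P3 z) -> (count P3 rs <= 1)%N ->
    (count P1 rs <= (count P2 rs).+1)%N.
  move=> h c3; apply: (@leq_trans (count P2 rs + count P3 rs)%N); last by lia.
  rewrite -count_predUI; apply: leq_trans (leq_addr _ _).
  rewrite -!size_filter; apply: uniq_leq_size; first exact: filter_uniq.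
  by move=> z; rewrite !mem_filter => /andP[/[swap] zr /(h _ zr) /= ->].
have same i (b : bool) : (i < N)%N -> 0 < (-1) ^+ b * p.[a i] -> odd (H i) = b.
  move=> iN; have := par i iN; rewrite -(signr_odd _ (H i)).
  by case: (odd _); case: b => //; rewrite ?expr0 ?expr1 ?mul1r ?mulN1r oppr_gt0 => h1 h2;
     have := lt_trans h1 h2; rewrite ltxx.
have noamono i j : (i < j < N)%N -> a j < a i -> False.
  by move=> /amono h /(lt_trans h); rewrite ltxx.
(* Rolle's theorem is applied to the left of [a 0], between consecutive critical points, and to the
   right of the last one. *)
apply: (@upper_counts_determined N s (size rs) H) => //.
- rewrite count_size -(count_predT rs) /=; apply: (split_le _ _ (< a 0%N)).
    by move=> z zr _ /=; have : z != a 0%N; [apply: contraNneq (anr _ N0) => <- | case: ltgtP].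
  apply: (uniq_between_critical pE urs) => [u c' v _ va _ cv|d da].
    exact: lt_trans cv va.
  apply/negP => /dproot[j jN dj].
  move: da; rewrite dj; case: (posnP j) => [->|j0]; first by rewrite /= ltxx.
  by move=> h; apply: (noamono 0%N j) h; lia.
- move=> i iN; apply/andP; split.
    by apply: sub => z; apply: lt_trans; apply: amono; rewrite ltnSn.
  apply: (split_le _ _ (fun z => (a i < z) && (z < a i.+1))).
  + move=> z zr az; have : z != a i.+1 by apply: contraNneq (anr _ iN) => <-.
    by rewrite az /=; case: ltgtP.
  + apply: (uniq_between_critical pE urs) => [u c' v /andP[ua _] /andP[_ va] uc cv|d /andP[ad da]].
      by rewrite (lt_trans ua uc) (lt_trans cv va).
    apply/negP => /dproot[j jN dj].
    move: ad da; rewrite dj => ad da.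
    case: (ltngtP j i) => [ji|ij|ij].
    - apply: (noamono j i) ad; lia.
    - case: (ltngtP j i.+1) => [||E]; [lia| |by move: da; rewrite E ltxx].
      by move=> h; apply: (noamono i.+1 j) da; lia.
    - by move: ad; rewrite ij ltxx.
- apply: (uniq_between_critical pE urs) => [u c' v ua _ uc _|d da].
    exact: lt_trans ua uc.
  apply/negP => /dproot[j jN dj].
  move: da; rewrite dj; case: (ltngtP j N.-1) => [h|h|->]; [|lia|by rewrite /= ltxx].
  by move=> h'; apply: (noamono j N.-1) h'; lia.
- by move=> i is2 iN; rewrite (same i false) // expr0 mul1r sgn1.
- by move=> i is2 iN; apply: same => //; rewrite signr_odd; apply: sgn2.
Qed.
End RealRoots.

(** * From complex roots to the real closed field of real algebraic numbers *)

Lemma rootsC_prod (P : {poly int}) : P \is monic ->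
  map_poly toC P = \prod_(z <- rootsC P) ('X - z%:P).
Proof.
move=> Pm; rewrite /rootsC; case: closed_field_poly_normal => rs /= {1}->.
by rewrite (monicP (monic_map _ Pm)) scale1r.
Qed.

Lemma size_rootsC (P : {poly int}) : P \is monic -> size P = (size (rootsC P)).+1.
Proof.
move=> Pm; rewrite -(size_prod_XsubC _ id) -rootsC_prod //.
by rewrite size_map_inj_poly //; apply: intr_inj.
Qed.

(** Nonreal roots come in conjugate pairs, whose quadratic factors are positive on [algR] and make
    up [q]; the pairing also gives the parity. *)
Lemma real_factorization (P : {poly int}) : P \is monic ->
  exists rs : seq algR, exists q : {poly algR},
    [/\ map_poly intr P = \prod_(z <- rs) ('X - z%:P) * q,
        forall x, 0 < q.[x],
        size rs = nreal_roots P & odd (size rs) = odd (size P).-1].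
Proof.
move=> Pm; set p := map_poly _ P.
have pm : p \is monic by apply: monic_map.
have [r] := poly_algR_pfactor p; rewrite (monicP pm) scale1r => pr.
have pC : map_poly algRval p = map_poly toC P.
  by rewrite /p -map_poly_comp; apply: eq_map_poly => x /=; rewrite rmorph_int.
pose rs := [seq insubd (0 : algR) z | z <- r & z \is Num.real].
pose q := \prod_(z <- r | z \isn't Num.real) algR_pfactor z.
have valrs : [seq val z | z <- rs] = [seq z <- r | z \is Num.real].
  rewrite -map_comp -[RHS]map_id; apply/eq_in_map => z.
  by rewrite mem_filter => /andP[zr _] /=; rewrite insubdK.
have Dp : p = \prod_(z <- rs) ('X - z%:P) * q.
  apply: (map_poly_inj algRval); rewrite pr rmorphM rmorph_prod /= (bigID (fun z => z \is Num.real)) /=.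
  congr (_ * _); last by rewrite rmorph_prod.
  rewrite -big_filter -valrs big_map; apply: eq_bigr => z _.
  by rewrite algC_pfactorRE ?algRvalP // rmorphB /= map_polyX map_polyC.
(* A nonreal entry of [r] stands for a quadratic factor, hence for itself and its conjugate. *)
have rootsP : perm_eq (rootsC P)
    ([seq z <- r | z \is Num.real] ++
     flatten [seq [:: z; z^*] | z <- r & z \isn't Num.real]).
  apply: prod_XsubC_eq; rewrite -rootsC_prod // -pC pr (bigID (fun z => z \is Num.real)) /= big_cat /=.
  congr (_ * _).
    rewrite -big_filter; apply: eq_big_seq => z; rewrite mem_filter => /andP[zr _].
    by rewrite algC_pfactorRE.
  rewrite big_flatten /= big_map -big_filter; apply: eq_big_seq => z.
  rewrite mem_filter => /andP[zr _].
  by rewrite algC_pfactorCE // big_cons big_seq1.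
have szrs : size rs = count (fun z => z \is Num.real) r by rewrite size_map size_filter.
exists rs, q; split => //.
- move=> x; rewrite horner_prod; apply: prodr_gt0 => z zr.
  rewrite (_ : (0 < ?[a]) = (algRval 0 < algRval ?a)) //= -horner_map /=.
  exact: algC_pfactorCgt0 zr (algRvalP x).
- rewrite /nreal_roots (permP rootsP) count_cat count_filter szrs.
  rewrite [X in (_ + X)%N](_ : _ = 0%N) ?addn0.
    by apply: eq_count => z /=; rewrite andbb.
  apply/eqP; rewrite eqn0Ngt -has_count; apply/hasPn => z /flattenP[l /mapP[w]].
  rewrite mem_filter => /andP[wr _] -> ; rewrite !inE => /orP[] /eqP -> //.
  by rewrite /= CrealJ.
- rewrite (size_rootsC Pm) /= (perm_size rootsP) size_cat size_filter szrs oddD.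
  have -> (l : seq algC) : size (flatten [seq [:: z; z^*] | z <- l]) = (size l).*2.
    by elim: l => //= z l ->; lia.
  by rewrite odd_double addbF.
Qed.

Lemma nreal_roots_critical (P : {poly int}) (a : nat -> rat) (N s : nat) (c : rat) :
  (0 < N)%N -> (2 * s <= N.+1)%N -> P \is monic -> size P = N.+2 -> c != 0 ->
  (map_poly (intr : int -> rat) P)^`() = c *: \prod_(i < N) ('X - (a i)%:P) ->
  (forall i j, (i < j < N)%N -> a i < a j) ->
  (forall i, (i < 2 * s)%N -> (i < N)%N -> 0 < (map_poly intr P).[a i]) ->
  (forall i, (2 * s <= i)%N -> (i < N)%N -> 0 < (-1) ^+ (N - i) * (map_poly intr P).[a i]) ->
  nreal_roots P = (N.+1 - 2 * s)%N.
Proof.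
move=> N0 sN Pm szP c0 dP amono s1 s2.
have [rs [q [E q0 <- od]]] := real_factorization Pm.
have mapE : map_poly intr P = map_poly (ratr : rat -> algR) (map_poly intr P).
  by rewrite -map_poly_comp; apply: eq_map_poly => x /=; rewrite ratr_int.
apply: (@count_real_roots _ _ q rs (fun i => ratr (a i)) N s (ratr c)) E q0 _ _ _ _ _ => //.
- by rewrite od szP.
- by rewrite fmorph_eq0.
- rewrite mapE deriv_map dP map_polyZ rmorph_prod /=; congr (_ *: _).
  by apply: eq_bigr => i _; rewrite rmorphB /= map_polyX map_polyC.
- by move=> i j /amono; rewrite ltr_rat.
- by move=> i h1 h2; rewrite mapE horner_map /= ltr0q s1.
- move=> i h1 h2; rewrite mapE horner_map /=.
  by have := s2 i h1 h2; rewrite -(ltr0q algR) rmorphM rmorph_sign.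
Qed.

(** * The discriminant in terms of critical values *)

(** This is [n (n - 1) / 2], in the form in which a product over pairs produces it. *)
Definition disc_sign (n : nat) : nat := \sum_(i < n) #|[pred j : 'I_n | (i < j)%N]|.

Lemma prod_diff_roots (F : comPzRingType) (n : nat) (r : 'I_n -> F) :
  \prod_(i < n) \prod_(j < n | j != i) (r i - r j) =
  (-1) ^+ disc_sign n *
  \prod_(i < n) \prod_(j < n | (i < j)%N) (r i - r j) ^+ 2.
Proof.
have -> : \prod_(i < n) \prod_(j < n | j != i) (r i - r j) =
  \prod_(i < n) \prod_(j < n | (i < j)%N) (r i - r j) *
  \prod_(i < n) \prod_(j < n | (j < i)%N) (r i - r j).
  rewrite -big_split /=; apply: eq_bigr => i _.
  rewrite (bigID (fun j : 'I_n => (i < j)%N)) /=; congr (_ * _).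
    by apply: eq_bigl => j; rewrite -val_eqE /=; case: ltngtP.
  by apply: eq_bigl => j; rewrite -val_eqE /=; case: ltngtP.
rewrite [X in _ * X](exchange_big_dep xpredT) //= -big_split /=.
rewrite /disc_sign -prodrXr -big_split /=; apply: eq_bigr => i _.
rewrite -prodr_const -!big_split /=; apply: eq_bigr => j _.
ring.
Qed.

(** Up to sign the discriminant is the product of [P'] over the roots of [P]. Factoring [P'] over
    its own roots and exchanging the double product turns it into the product of [P] over the
    critical points. *)
Lemma discC_critical (P : {poly int}) (a : nat -> algC) (N : nat) :
  P \is monic -> size P = N.+2 ->
  (map_poly toC P)^`() = N.+1%:R *: \prod_(i < N) ('X - (a i)%:P) ->
  discC P = (-1) ^+ disc_sign N.+1 * N.+1%:R ^+ N.+1 * \prod_(i < N) (map_poly toC P).[a i].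
Proof.
move=> Pm szP dP; have Pprod := rootsC_prod Pm; rewrite /discC.
have : size (rootsC P) = N.+1 by have := size_rootsC Pm; rewrite szP => -[].
move: (rootsC P) Pprod => rs Pprod szr; rewrite szr.
have Pord : map_poly toC P = \prod_(i < N.+1) ('X - (rs`_i)%:P).
  by rewrite Pprod (big_nth 0) big_mkord szr.
have dPr (i : 'I_N.+1) : (map_poly toC P)^`().[rs`_i] = \prod_(j < N.+1 | j != i) (rs`_i - rs`_j).
  rewrite Pord (bigD1 i) //= derivM derivXsubC mul1r hornerD hornerM hornerXsubC subrr mul0r addr0.
  by rewrite horner_prod; apply: eq_bigr => j _; rewrite hornerXsubC.
have Pa x : (map_poly toC P).[x] = \prod_(i < N.+1) (x - rs`_i).
  by rewrite Pord horner_prod; apply: eq_bigr => j _; rewrite hornerXsubC.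
have := prod_diff_roots (fun i : 'I_N.+1 => rs`_i); under eq_bigr => i _ do rewrite -dPr.
under eq_bigr => i _ do rewrite dP hornerZ horner_prod.
rewrite big_split /= prodr_const card_ord => E.
set D := (X in X = _).
have -> : D = (-1) ^+ disc_sign N.+1 * ((-1) ^+ disc_sign N.+1 * D).
  by rewrite mulrA -expr2 sqrr_sign mul1r.
rewrite {}/D -E -mulrA; congr (_ * (_ * _)).
rewrite exchange_big /=.
transitivity (\prod_(i < N) ((-1) ^+ N.+1 * (map_poly toC P).[a i])).
  apply: eq_bigr => i _; rewrite Pa -[X in (-1) ^+ X]card_ord -prodr_const -big_split /=.
  by apply: eq_bigr => j _; rewrite hornerXsubC; ring.
rewrite big_split /= prodr_const card_ord -exprM.
(* [N (N + 1)] is even, so reversing all differences between roots and critical points costs no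
   sign. *)
by rewrite -signr_odd oddM /= andNb mul1r.
Qed.

(** * Irreducibility modulo a prime *)

Lemma monic_large_value (f : {poly int}) (n : nat) : f \is monic -> (1 < size f)%N -> (0 < n)%N ->
  exists k : nat, 1 < f.[(n * k)%:R].
Proof.
(* A polynomial with positive leading coefficient is eventually at least that coefficient; the shift
   by 2 makes the resulting bound on [f] strict. *)
move=> fm sf n0; pose q : {poly rat} := map_poly intr f - 2%:P.
have [|A HA] := @polyrcf.poly_pinfty_gt_lc _ q.
  rewrite /q lead_coefDl ?(monicP (monic_map _ fm)) //.
  rewrite size_polyN size_map_inj_poly //; last exact: intr_inj.
  exact: leq_ltn_trans (size_polyC_leq1 _) sf.
have lq : lead_coef q = 1.
  rewrite /q lead_coefDl ?(monicP (monic_map _ fm)) //.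
  rewrite size_polyN size_map_inj_poly //; last exact: intr_inj.
  exact: leq_ltn_trans (size_polyC_leq1 _) sf.
exists (Num.bound A).
have := HA (n * Num.bound A)%:R; rewrite lq /q hornerD hornerN hornerC.
have h : A <= (n * Num.bound A)%:R.
  apply: le_trans (ler_norm A) _; apply: ltW.
  apply: (lt_le_trans (archi_boundP (normr_ge0 A))).
  rewrite (_ : Num.bound `|A| = Num.bound A) ?ler_nat ?leq_pmull //.
  by rewrite /Num.bound normr_id.
move=> /(_ h).
have -> : (n * Num.bound A)%:R = ((n * Num.bound A)%:R : int)%:~R :> rat by rewrite rmorph_nat.
rewrite horner_map /= -(ltr_int rat); lra.
Qed.

Lemma Fp_fermat (l : nat) (x : 'F_l) : prime l -> x != 0 -> x ^+ l.-1 = 1.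
Proof.
move=> pl x0; apply: (mulfI x0); rewrite mulr1 -exprS prednK ?prime_gt0 //.
by have := expf_card x; rewrite card_Fp.
Qed.

(* Any prime factor of a large value of the [n]-th cyclotomic polynomial at a multiple of [n]. *)
Lemma prime_1mod (n : nat) : (0 < n)%N -> exists2 l, prime l & (n %| l.-1)%N.
Proof.
move=> n0.
have [||//|k fk] := @monic_large_value 'Phi_n n; first exact: Cyclotomic_monic.
  by rewrite size_Cyclotomic ltnS totient_gt0.
set a0 : int := (n * k)%:R in fk.
pose m := `|('Phi_n).[a0]|%N; pose l := pdiv m.
have m1 : (1 < m)%N by rewrite /m; lia.
have pl : prime l := pdiv_prime m1.
exists l => //.
pose a : 'F_l := a0%:~R.
have aP d : (map_poly intr ('Phi_d)).[a] = (('Phi_d).[a0])%:~R :> 'F_l by rewrite -horner_map.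
have Phi0 : (map_poly intr 'Phi_n).[a] = 0.
  rewrite aP; apply/eqP; have : (l %| m)%N := pdiv_dvd m.
  rewrite (dvdn_pcharf (pchar_Fp pl)) /m; case: ('Phi_n).[a0] => u /=; rewrite ?NegzE //.
  by rewrite rmorphN /= oppr_eq0.
pose q := \prod_(d <- rem n (divisors n)) 'Phi_d.
have defXn : map_poly intr 'Phi_n * map_poly intr q = 'X^n - 1 :> {poly 'F_l}.
  have E : 'Phi_n * q = 'X^n - 1 by rewrite -prod_Cyclotomic // (big_rem n) -?dvdn_divisors.
  by rewrite -rmorphM /= E rmorphB /= rmorph1 map_polyXn.
have an1 : a ^+ n = 1.
  have : ('X^n - 1 : {poly 'F_l}).[a] = 0 by rewrite -defXn hornerM Phi0 mul0r.
  by rewrite !hornerE => /eqP; rewrite subr_eq0 => /eqP.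
(* As [a0] is a multiple of [n], the vanishing of [n] in ['F_l] would entail that of [a]. *)
have n_neq0 : n%:R != 0 :> 'F_l.
  apply/eqP => n0'; have := an1; rewrite /a /a0 natrM rmorphM /= rmorph_nat n0' mul0r.
  by rewrite expr0n -[n == _]negbK -lt0n n0 => /esym/eqP; rewrite oner_eq0.
have cop : coprimep (map_poly intr 'Phi_n) (map_poly intr q : {poly 'F_l}).
  have := separable_Xn_sub_1 n_neq0; rewrite -defXn separable_mul.
  by case/and3P.
have [m' prim_a m'n] := prim_order_exists n0 an1.
(* If the order [m'] of [a] were a proper divisor of [n], [a] would be a root of some ['Phi_d] with
   [d] dividing [m'], hence of [q], against coprimality. *)
suff -> : n = m'.
  rewrite (prim_order_dvd prim_a) Fp_fermat //; apply/eqP => a00; have := an1; rewrite a00.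
  by rewrite expr0n -[n == _]negbK -lt0n n0 => /esym/eqP; rewrite oner_eq0.
apply/eqP; rewrite eq_sym; apply/negPn/negP => m'n'.
have m'0 := prim_order_gt0 prim_a.
have : (map_poly intr q).[a] != 0 by apply: (coprimep_root cop); rewrite /root Phi0.
have : ('X^m' - 1 : {poly 'F_l}).[a] = 0.
  by rewrite !hornerE (prim_expr_order prim_a) subrr.
have -> : 'X^m' - 1 = map_poly intr (\prod_(d <- divisors m') 'Phi_d) :> {poly 'F_l}.
  by rewrite prod_Cyclotomic // rmorphB /= rmorph1 map_polyXn.
rewrite rmorph_prod horner_prod => /eqP; rewrite prodf_seq_eq0 => /hasP[d dm' /= d0].
rewrite rmorph_prod horner_prod prodf_seq_neq0 => /allP /(_ d) /=; rewrite d0 => /(_ _)/negP; apply=> //.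
rewrite -dvdn_divisors // in dm'.
rewrite mem_rem_uniq ?divisors_uniq // !inE -dvdn_divisors // (dvdn_trans dm' m'n) andbT.
apply: contra m'n' => /eqP dn; rewrite eqn_dvd m'n -dn //.
Qed.

Lemma Fp_prim_root (l : nat) : prime l -> exists g : 'F_l, (l.-1).-primitive_root g.
Proof.
move=> pl.
have l1 : (0 < l.-1)%N by rewrite -subn1 subn_gt0 prime_gt1.
have := @has_prim_root 'F_l l.-1 (enum (predC1 (0 : 'F_l))) l1.
case/(_ _ _ _)/hasP => [| | |g _ hg]; last by exists g.
- by apply/allP => x; rewrite mem_enum !inE => x0; rewrite unity_rootE Fp_fermat.
- exact: enum_uniq.
- by rewrite -cardE cardC1 card_Fp.
Qed.

(* The product [delta] of the roots of [h], up to sign its constant term, satisfies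
   [delta ^+ n = g ^+ deg h]; comparing discrete logarithms gives [n %| deg h]. *)
Lemma factor_Xn_sub_prim (l n : nat) (g : 'F_l) (h r : {poly 'F_l}) :
  prime l -> (l.-1).-primitive_root g -> (n %| l.-1)%N -> h * r = 'X^n - g%:P -> (n %| (size h).-1)%N.
Proof.
move=> pl; set m := l.-1 => pg nm hr.
have [K [f _]] := countable_algebraic_closure 'F_l.
have Eg : g ^+ m = 1 := prim_expr_order pg.
have g0 : g != 0.
  apply/eqP => g0; have := Eg; rewrite g0 expr0n -[m == _]negbK -lt0n (prim_order_gt0 pg).
  by move/esym/eqP; rewrite oner_eq0.
have n0 : (0 < n)%N by apply: dvdn_gt0 (prim_order_gt0 pg) nm.
have hr0 : h * r != 0 by rewrite hr -size_poly_gt0 size_XnsubC.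
have h0 : h != 0 by apply: contraNneq hr0 => ->; rewrite mul0r.
have [rs hrs] := closed_field_poly_normal (map_poly f h).
have lh0 : lead_coef h != 0 by rewrite lead_coef_eq0.
have szrs : (size h).-1 = size rs.
  rewrite -(size_map_poly f) hrs size_scale ?size_prod_XsubC //.
  by rewrite lead_coef_map fmorph_eq0.
(* The roots of [h] live in the closure [K], but their product is read off the coefficients and so
   lies in ['F_l]. *)
rewrite szrs; pose delta := (-1) ^+ size rs * h.[0] / lead_coef h.
have prodN (t : seq K) : \prod_(z <- t) (0 - z) = (-1) ^+ size t * \prod_(z <- t) z.
  elim: t => [|z t IH]; first by rewrite !big_nil mulr1.
  by rewrite !big_cons /= IH exprS; ring.
have fh0 : f h.[0] = f (lead_coef h) * ((-1) ^+ size rs * \prod_(z <- rs) z).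
  rewrite -horner_map hrs lead_coef_map hornerZ horner_prod rmorph0 -prodN.
  by congr (_ * _); apply: eq_bigr => z _; rewrite hornerXsubC.
have fdelta : f delta = \prod_(z <- rs) z.
  rewrite /delta !rmorphM /= fmorphV rmorphXn rmorphN1 fh0.
  have fl0 : f (lead_coef h) != 0 by rewrite fmorph_eq0.
  transitivity (((-1) ^+ size rs) ^+ 2 * \prod_(z <- rs) z); first by field.
  by rewrite sqrr_sign mul1r.
have rsn z : z \in rs -> z ^+ n = f g.
  move=> zrs; have : root (map_poly f ('X^n - g%:P)) z.
    rewrite -hr rmorphM rootM /=; apply/orP; left; rewrite hrs rootZ ?root_prod_XsubC //.
    by rewrite lead_coef_map fmorph_eq0.
  by rewrite /root rmorphB /= map_polyXn map_polyC !hornerE subr_eq0 => /eqP.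
have dn : delta ^+ n = g ^+ size rs.
  apply: (fmorph_inj f); rewrite !rmorphXn /= fdelta -prodrXl.
  elim: (rs) rsn => [|z t IH] hl; first by rewrite big_nil.
  rewrite big_cons exprS hl ?mem_head // IH // => w wl; apply: hl.
  by rewrite inE wl orbT.
have [k dk] : {k : 'I_m | delta = g ^+ k}.
  apply: (prim_rootP pg); apply: Fp_fermat => //; apply/eqP => d0.
  have := dn; rewrite d0 expr0n -[n == _]negbK -lt0n n0 => /esym/eqP.
  by rewrite expf_eq0 (negPf g0) andbF.
(* The exponents agree modulo the order [m] of [g], hence modulo its divisor [n], where [k * n]
   vanishes. *)
move/eqP: dn; rewrite dk -exprM (eq_prim_root_expr pg) => /eqP E.
have : (k * n = size rs %[mod n])%N by rewrite -(modn_dvdm _ nm) E modn_dvdm.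
by rewrite modnMl => /esym/eqP.
Qed.

(** By Gauss's lemma a rational factor may be taken integral. As [P] is monic, its leading
    coefficient is a unit, so its degree survives reduction modulo [l], where it must be a multiple
    of [n]. *)
Lemma irreducible_mod_Xn_sub_prim (P : {poly int}) (l n : nat) (g : 'F_l) :
  (0 < n)%N -> prime l -> (l.-1).-primitive_root g -> (n %| l.-1)%N ->
  P \is monic -> size P = n.+1 -> map_poly intr P = 'X^n - g%:P ->
  irreducible_poly (map_poly (intr : int -> rat) P).
Proof.
move=> n0 pl pg nl Pm szP Pg; apply/irreducible_rat_int; split; first by rewrite szP.
move=> q szq qP; have [r Pr] := dvdpP_int qP.
set h := zprimitive q in Pr.
have P0 : P != 0 by rewrite monic_neq0.
have lcu : lead_coef h * lead_coef r = 1 by rewrite -lead_coefM -Pr (monicP Pm).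
have h0 : h != 0 by apply: contraNneq P0 => h0; rewrite Pr h0 mul0r.
have r0 : r != 0 by apply: contraNneq P0 => r0; rewrite Pr r0 mulr0.
have szh : size h = size q by rewrite size_zprimitive.
have lF : (lead_coef h)%:~R * (lead_coef r)%:~R = 1 :> 'F_l by rewrite -rmorphM lcu rmorph1.
have lh0 : (lead_coef h)%:~R != 0 :> 'F_l.
  by apply/eqP => e; have := lF; rewrite e mul0r => /esym/eqP; rewrite oner_eq0.
have szmap : size (map_poly intr h : {poly 'F_l}) = size h by apply: size_map_poly_id0.
have hr : map_poly intr h * map_poly intr r = 'X^n - g%:P by rewrite -Pg Pr rmorphM.
have := factor_Xn_sub_prim pl pg nl hr; rewrite szmap => dv.
have szhr : (size h + size r = n.+2)%N.
  have := congr1 (fun p : {poly int} => size p) Pr; rewrite /= szP size_mul //.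
  have : (0 < size h)%N by rewrite size_poly_gt0.
  by case: (size h) => // a _; rewrite addSn => ->.
have sh0 : (0 < (size h).-1)%N.
  have : (0 < size h)%N by rewrite size_poly_gt0.
  move: szq; rewrite -szh; lia.
have hn : (n <= (size h).-1)%N by apply: dvdn_leq.
have szr : size r = 1%N.
  have : (0 < size r)%N by rewrite size_poly_gt0.
  lia.
apply: eqp_trans (_ : q %= h) _.
  rewrite {1}(zpolyEprim q) eqp_scale // zcontents_eq0 //.
  by apply: contraNneq h0 => q0; rewrite /h q0 zprimitive0.
have [c c0 rc] : exists2 c, c != 0 & r = c%:P.
  by have /eqP/size_poly1P[c c0 rc] := szr; exists c.
by rewrite Pr rc mulrC mul_polyC eqp_sym eqp_scale.
Qed.

(** * Prescribing the critical points *)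

Section Spiral.
Variable R : archiRealFieldType.
Implicit Types (p q : {poly R}) (s : seq R) (a x : R).

Definition antideriv p : {poly R} :=
  \poly_(i < (size p).+1) (if i is j.+1 then p`_j / j.+1%:R else 0).

Lemma coef_antideriv p j : (antideriv p)`_j.+1 = p`_j / j.+1%:R.
Proof.
rewrite coef_poly ltnS; case: ltnP => // h.
by rewrite nth_default // mul0r.
Qed.

Lemma coef0_antideriv p : (antideriv p)`_0 = 0.
Proof. by rewrite coef_poly. Qed.

Lemma deriv_antideriv p : (antideriv p)^`() = p.
Proof.
apply/polyP => i; rewrite coef_deriv coef_antideriv -[_ *+ _]mulr_natr mulfVK //.
by rewrite pnatr_eq0.
Qed.

Lemma antideriv_unique p q : p^`() = q -> p`_0 = 0 -> antideriv q = p.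
Proof.
move=> <- p0; apply/polyP => -[|i]; first by rewrite coef0_antideriv p0.
by rewrite coef_antideriv coef_deriv -[_ *+ _]mulr_natr mulfK // pnatr_eq0.
Qed.

(** The factors are [x - X] rather than [X - x] so that, for a spiral, the sign of the [i]-th
    critical value depends on [i] and not on the length of [s]; points can then be appended on the
    right. *)
Definition crit_poly s : {poly R} := antideriv (\prod_(x <- s) (x%:P - 'X)).

(** The dependence on the new point [a] is affine, with the old polynomial as slope: for large [a]
    the old polynomial governs the values at the old points. *)
Lemma crit_poly_rcons s a :
  crit_poly (rcons s a) = a *: crit_poly s - antideriv ('X * \prod_(x <- s) (x%:P - 'X)).
Proof.
apply: antideriv_unique.
  rewrite derivB derivZ !deriv_antideriv big_rcons /= -mul_polyC; ring.
by rewrite coefB coefZ !coef0_antideriv mulr0 subr0.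
Qed.

Definition crit_height s (i : nat) : R := (-1) ^+ i * (crit_poly s).[s`_i].

(* The critical points of [crit_poly s] are the entries of [s]; the conditions say that
   its critical values alternate in sign and grow in absolute value. *)
Definition spiral s : Prop :=
  [/\ forall i, (i < size s)%N -> 0 < s`_i,
      forall i j, (i < j < size s)%N -> s`_i < s`_j,
      forall i, (i < size s)%N -> 0 < crit_height s i &
      forall i j, (i < j < size s)%N -> crit_height s i < crit_height s j].

Definition eventually_ge (Q : R -> Prop) : Prop := exists A, forall a, A <= a -> Q a.

Lemma eventually_geW (Q1 Q2 : R -> Prop) :
  (forall a, Q1 a -> Q2 a) -> eventually_ge Q1 -> eventually_ge Q2.
Proof. by move=> h [A HA]; exists A => a /HA /h. Qed.

Lemma eventually_ge_and (Q1 Q2 : R -> Prop) :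
  eventually_ge Q1 -> eventually_ge Q2 -> eventually_ge (fun a => Q1 a /\ Q2 a).
Proof.
move=> [A HA] [B HB]; exists (Num.max A B) => a; rewrite ge_max => /andP[/HA ? /HB ?].
by split.
Qed.

Lemma eventually_ge_all (n : nat) (Q : nat -> R -> Prop) :
  (forall i, (i < n)%N -> eventually_ge (Q i)) ->
  eventually_ge (fun a => forall i, (i < n)%N -> Q i a).
Proof.
elim: n => [|n IH] h; first by exists 0.
have h1 := IH (fun i iN => h i (ltnW iN)); have h2 := h n (leqnn _).
apply: eventually_geW (eventually_ge_and h1 h2) => a [a1 a2] i.
by rewrite ltnS leq_eqVlt => /orP[/eqP -> | /a1].
Qed.

Lemma eventually_ge_poly p (m : nat) : (size p <= m.+1)%N -> 0 < p`_m ->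
  eventually_ge (fun a => 0 < p.[a]).
Proof.
move=> szp pm; have szp' : size p = m.+1.
  apply/eqP; rewrite eqn_leq szp ltnNge; apply: contraTN pm => h.
  by rewrite nth_default // ltxx.
have lp : 0 < lead_coef p by rewrite lead_coefE szp'.
have [A HA] := polyrcf.poly_pinfty_gt_lc lp.
by exists A => a /HA; apply: lt_le_trans.
Qed.

Lemma eventually_ge_affine (u v : R) : 0 < u -> eventually_ge (fun a => 0 < a * u - v).
Proof.
move=> u0; apply: (eventually_geW (Q1 := fun a => 0 < (u *: 'X - v%:P).[a])).
  by move=> a; rewrite !hornerE mulrC.
apply: (@eventually_ge_poly _ 1).
  apply/leq_sizeP => -[|[|j]] // _.
  by rewrite coefB coefZ coefX coefC /= mulr0 subrr.
by rewrite coefB coefZ coefX coefC /= mulr1 subr0.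
Qed.

(** With [k = size s], the new height is a polynomial in [a] of degree [k + 2] and leading
    coefficient [1 / (k + 1) - 1 / (k + 2)], so it outgrows affine functions. *)
Lemma last_height_dominates s (u v : R) : (size s = 0%N -> u = 0) ->
  eventually_ge (fun a => a * u - v < crit_height (rcons s a) (size s)).
Proof.
move=> u0; set k := size s.
set D := \prod_(x <- s) (x%:P - 'X : {poly R}).
have szD : size D = k.+1 /\ (-1) ^+ k * D`_k = 1.
  rewrite /D /k; elim: (s) => [|x t [sz lc]]; first by rewrite big_nil size_poly1 coef1 mulr1.
  have E : x%:P - 'X = - ('X - x%:P) by rewrite opprB.
  rewrite big_cons E mulNr size_polyN.
  have szM : size (('X - x%:P) * \prod_(j <- t) (j%:P - 'X)) = (size t).+2.
    by rewrite mulrC size_Mmonic ?monicXsubC -?size_poly_gt0 ?sz // size_XsubC addn2.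
  split=> //=; rewrite coefN mulrBl coefB coefXM coefCM /= (nth_default 0 _ : _`_(size t).+1 = 0) ?sz //.
  by rewrite mulr0 subr0 exprS -[RHS]lc; ring.
have [szD1 lcD] := szD.
pose q := (-1) ^+ k *: ('X * crit_poly s - antideriv ('X * D)) - u *: 'X + v%:P.
apply: (eventually_geW (Q1 := fun a => 0 < q.[a])) => [a|].
  rewrite /q /crit_height nth_rcons ltnn eqxx crit_poly_rcons -/D.
  rewrite !(hornerD, hornerN, hornerZ, hornerM, hornerX, hornerC); lra.
apply: (@eventually_ge_poly _ k.+2).
  apply/leq_sizeP => -[|[|[|j]]] // kj.
  rewrite /q coefD coefC /= addr0 coefB !coefZ coefX coefB coefXM /= !coef_antideriv coefXM /= -/D.
  by rewrite (nth_default 0 _ : D`_j.+1 = 0) ?szD1 // !mul0r subrr mulr0 mulr0 subrr.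
rewrite /q coefD coefC /= addr0 coefB !coefZ coefX coefB coefXM /= !coef_antideriv coefXM /= -/D.
have -> : u * (k.+2 == 1)%:R = 0 by rewrite mulr0.
rewrite subr0 mulrBr !mulrA lcD !mul1r subr_gt0 ltf_pV2 ?posrE ?ltr0n //.
by rewrite ltr_nat.
Qed.

(** Each old height is multiplied by [a] and shifted by a constant, so positivity and order persist
    for large [a], while the new height grows at least quadratically. *)
Lemma spiral_rcons s : spiral s -> eventually_ge (fun a => spiral (rcons s a)).
Proof.
move=> [s0 s1 h0 h1]; set k := size s.
pose e i := (-1) ^+ i * (antideriv ('X * \prod_(x <- s) (x%:P - 'X))).[s`_i].
have hE a i : (i < k)%N -> crit_height (rcons s a) i = a * crit_height s i - e i.
  move=> ik; rewrite /crit_height /e nth_rcons ik crit_poly_rcons hornerD hornerN hornerZ; ring.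
have ev1 : eventually_ge (fun a => forall i, (i < k)%N -> 0 < a * crit_height s i - e i).
  by apply: eventually_ge_all => i ik; apply: eventually_ge_affine; apply: h0.
have ev2 : eventually_ge (fun a => forall j, (j < k)%N -> forall i, (i < j)%N ->
   0 < a * (crit_height s j - crit_height s i) - (e j - e i)).
  apply: eventually_ge_all => j jk; apply: eventually_ge_all => i ij.
  by apply: eventually_ge_affine; rewrite subr_gt0 h1 // ij.
have ev3 : eventually_ge (fun a => forall i, (i < k)%N ->
   a * crit_height s i - e i < crit_height (rcons s a) k).
  apply: eventually_ge_all => i ik; apply: last_height_dominates => k0.
  by move: ik; rewrite /k k0.
have ev4 : eventually_ge (fun a => a * 0 - 0 < crit_height (rcons s a) k).
  exact: last_height_dominates.
have ev5 : eventually_ge (fun a => forall i, (i < k)%N -> s`_i < a).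
  apply: eventually_ge_all => i ik; exists (s`_i + 1) => a; lra.
have ev6 : eventually_ge (fun a => 0 < a) by exists 1 => a; lra.
apply: eventually_geW (eventually_ge_and ev1 (eventually_ge_and ev2 (eventually_ge_and ev3
  (eventually_ge_and ev4 (eventually_ge_and ev5 ev6))))) => a [a1 [a2 [a3 [a4 [a5 a6]]]]].
have cases i : (i < size (rcons s a))%N -> (i < k)%N \/ i = k.
  by rewrite size_rcons ltnS leq_eqVlt => /orP[/eqP ->|]; [right|left].
have nk i : (i < k)%N -> (rcons s a)`_i = s`_i by rewrite nth_rcons => ->.
have nl : (rcons s a)`_k = a by rewrite nth_rcons ltnn eqxx.
split.
- by move=> i /cases[ik|->]; [rewrite nk // s0|rewrite nl].
- move=> i j /andP[ij /cases[jk|jk]].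
    by rewrite !nk // ?s1 ?ij // (ltn_trans ij jk).
  by rewrite jk nl nk ?a5 // -jk.
- move=> i /cases[ik|->]; first by rewrite hE // a1.
  by move: a4; rewrite mulr0 subrr.
- move=> i j /andP[ij /cases[jk|jk]].
    rewrite !hE ?(ltn_trans ij jk) //; have := a2 j jk i ij; lra.
  by rewrite jk hE ?a3 // -jk.
Qed.

Lemma eventually_ge_natmul (Q : R -> Prop) (K : R) : 0 < K -> eventually_ge Q ->
  exists u : nat, Q (K * u%:R).
Proof.
move=> K0 [A HA]; exists (Num.bound (A / K)); apply: HA.
rewrite mulrC -ler_pdivrMr //; apply: le_trans (ler_norm _) _.
have := archi_boundP (normr_ge0 (A / K)); rewrite (_ : Num.bound `|A / K| = Num.bound (A / K)).
  exact: ltW.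
by rewrite /Num.bound normr_id.
Qed.

Lemma spiral_nil : spiral [::].
Proof. by split=> // i j /andP[]. Qed.

Lemma spiral_int_exists (K N : nat) : (0 < K)%N ->
  exists t : seq int, [/\ size t = N, all (fun m : int => (K%:Z %| m)%Z) t & spiral (map intr t)].
Proof.
move=> K0; elim: N => [|N [t [szt dt st]]]; first by exists [::]; split => //; apply: spiral_nil.
have [|u Hu] := eventually_ge_natmul (K := K%:R) _ (spiral_rcons st); first by rewrite ltr0n.
exists (rcons t (K * u)%N); split; first by rewrite size_rcons szt.
  by rewrite all_rcons dt andbT PoszM dvdz_mulr.
by rewrite map_rcons /= -natrM in Hu *.
Qed.

End Spiral.

(** * Integral polynomials with rational critical points *)

Lemma coef_comp_scaleX (R : comNzRingType) (p : {poly R}) (c : R) i :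
  (p \Po (c *: 'X))`_i = p`_i * c ^+ i.
Proof.
rewrite comp_polyE coef_sum; case: (ltnP i (size p)) => ip.
  rewrite (bigD1 (Ordinal ip)) //= exprZn !coefZ coefXn eqxx mulr1 big1 ?addr0 //.
  move=> j ji; rewrite exprZn !coefZ coefXn (_ : i == j = false) ?mulr0 //.
  by apply: contra_neqF ji => /eqP e; apply: val_inj.
rewrite (nth_default 0 ip) mul0r big1 // => j _.
rewrite exprZn !coefZ coefXn (_ : i == j = false) ?mulr0 //.
by apply/eqP => e; have := ltn_ord j; rewrite -e ltnNge ip.
Qed.

Lemma comp_scaleX_inj (F : fieldType) (c : F) : c != 0 ->
  injective (fun p => p \Po (c *: 'X)).
Proof.
move=> c0 p q /polyP pq; apply/polyP => i; have := pq i.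
by rewrite !coef_comp_scaleX => /mulIf -> //; rewrite expf_neq0.
Qed.

(* [T ^+ n * P(X / T)]. *)
Definition scale_poly (n : nat) (T : int) (P : {poly int}) : {poly int} :=
  \poly_(j < n.+1) (P`_j * T ^+ (n - j)).

Section ScalePoly.
Variables (n : nat) (P : {poly int}).
Hypotheses (Pm : P \is monic) (szP : size P = n.+1).

Lemma coef_lead_eq1 : P`_n = 1.
Proof. by have /monicP := Pm; rewrite lead_coefE szP. Qed.

(** This serves twice: with [l] dividing [T], for irreducibility, and with [T = n], for the
    numerator of the critical value at [m / n]. *)
Lemma scale_poly_mod (T : int) : exists Q, scale_poly n T P = 'X^n + T *: Q.
Proof.
exists (\poly_(j < n) (P`_j * T ^+ (n - j).-1)).
apply/polyP => j; rewrite coefD coefZ coefXn !coef_poly.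
case: (ltngtP j n) => jn; rewrite ?ltnS ?(ltnW jn) //.
- rewrite add0r -[in LHS](@prednK (n - j)) ?subn_gt0 // exprS; ring.
- by rewrite leqNgt jn mulr0 addr0.
- by rewrite jn leqnn subnn expr0 mulr1 mulr0 addr0 coef_lead_eq1.
Qed.

Lemma horner_scale_poly (R : comNzRingType) (T : int) (x : R) :
  (map_poly intr (scale_poly n T P)).[T%:~R * x] = T%:~R ^+ n * (map_poly intr P).[x].
Proof.
rewrite (@horner_coef_wide _ n.+1); last first.
  by apply: leq_trans (size_poly _ _) _; apply: size_poly.
rewrite (@horner_coef_wide _ n.+1 (map_poly intr P)); last first.
  by apply: leq_trans (size_poly _ _) _; rewrite szP.
rewrite mulr_sumr; apply: eq_bigr => j _.
rewrite !coef_map /= coef_poly ltn_ord rmorphM rmorphXn /= exprMn.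
have -> : T%:~R ^+ n = T%:~R ^+ (n - j) * T%:~R ^+ j :> R.
  by rewrite -exprD subnK // -ltnS ltn_ord.
ring.
Qed.

Lemma size_scale_polyD (T c : int) : (0 < n)%N ->
  scale_poly n T P + c%:P \is monic /\ size (scale_poly n T P + c%:P) = n.+1.
Proof.
move=> n0.
have sz : size (scale_poly n T P) = n.+1.
  by apply: size_poly_eq; rewrite coef_lead_eq1 subnn expr0 mulr1 oner_eq0.
have szc : (size c%:P < size (scale_poly n T P))%N.
  by rewrite sz; apply: leq_ltn_trans (size_polyC_leq1 _) _.
split; last by rewrite size_polyDl.
rewrite monicE lead_coefDl // lead_coefE sz coef_poly ltnSn coef_lead_eq1 subnn expr0 mulr1.
by [].
Qed.

Lemma deriv_scale_poly (T c : int) (s : nat -> rat) : T != 0 -> (0 < n)%N ->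
  (map_poly toQ P)^`() = n%:R *: \prod_(i < n.-1) ('X - (s i)%:P) ->
  (map_poly toQ (scale_poly n T P + c%:P))^`() =
    n%:R *: \prod_(i < n.-1) ('X - (T%:~R * s i)%:P).
Proof.
move=> T0 n0 dP; have TQ : T%:~R != 0 :> rat by rewrite intr_eq0.
set F := map_poly toQ _.
have F' : (map_poly toQ (scale_poly n T P))^`() = F^`().
  by rewrite /F rmorphD /= map_polyC derivD derivC addr0.
have E : map_poly toQ (scale_poly n T P) \Po (T%:~R *: 'X) = T%:~R ^+ n *: map_poly toQ P.
  apply/polyP => j; rewrite coef_comp_scaleX coefZ !coef_map /= coef_poly ltnS.
  case: leqP => jn; last by rewrite mul0r nth_default ?szP // mulr0.
  rewrite rmorphM rmorphXn /= -mulrA -exprD subnK // mulrC //.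
(* Both sides are compared after substituting [T X] for [X], where the chain rule contributes a
   factor [T]. *)
apply: (comp_scaleX_inj TQ); apply: (mulIf (x := T%:~R%:P)); first by rewrite polyC_eq0.
have := congr1 (@deriv rat) E; rewrite deriv_comp F' derivZ derivX alg_polyC => ->.
have -> : T%:~R ^+ n = T%:~R * T%:~R ^+ n.-1 :> rat by rewrite -exprS prednK.
have B : \prod_(i < n.-1) (('X - (T%:~R * s i)%:P) \Po (T%:~R *: 'X)) =
         (T%:~R ^+ n.-1)%:P * \prod_(i < n.-1) ('X - (s i)%:P) :> {poly rat}.
  rewrite -[in X in X%:P](card_ord n.-1) -prodr_const rmorph_prod /= -big_split /=.
  apply: eq_bigr => i _; rewrite comp_polyB comp_polyX comp_polyC rmorphM /= mulrBr -mul_polyC //.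
rewrite derivZ dP comp_polyZ rmorph_prod /= B -!mul_polyC [(T%:~R * _)%:P]rmorphM /=; ring.
Qed.

End ScalePoly.

(* The [s i] are the critical points of [P] and [beta i / alpha i] its critical values, so that
   the discriminant of [scale_poly n T P + c%:P] is, up to sign, the product of the
   [alpha i * c + T ^+ n * beta i]. *)
Record critical_data (n : nat) (P : {poly int}) (s : nat -> rat) (alpha beta : nat -> int) : Prop :=
  CriticalData {
    cd_monic : P \is monic;
    cd_size : size P = n.+1;
    cd_deriv : (map_poly toQ P)^`() = n%:R *: \prod_(i < n.-1) ('X - (s i)%:P);
    cd_incr : forall i j, (i < j < n.-1)%N -> s i < s j;
    cd_sign : forall i, (i < n.-1)%N -> 0 < (-1) ^+ (n.-1 - i) * (map_poly toQ P).[s i];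
    cd_grow : forall i j, (i < j < n.-1)%N ->
      `|(map_poly toQ P).[s i]| < `|(map_poly toQ P).[s j]|;
    cd_val : forall i, (i < n.-1)%N ->
      (map_poly toQ P).[s i] = (beta i)%:~R / (alpha i)%:~R;
    cd_pos : forall i, 0 < alpha i;
    cd_prod : \prod_(i < n.-1) alpha i = n%:Z ^+ n;
    cd_xor : forall p i, prime p -> (p %| n)%N -> (i < n.-1)%N ->
      (p %| alpha i)%Z (+) (p %| beta i)%Z
  }.

Lemma prod_XsubC_mod (K : int) (t : seq int) : all (fun m : int => (K %| m)%Z) t ->
  exists Q, \prod_(x <- t) ('X - x%:P) = 'X^(size t) + K *: Q.
Proof.
elim: t => [|x t IH] /=; first by exists 0; rewrite big_nil scaler0 addr0.
case/andP=> /dvdzP[k ->] /IH[Q E]; rewrite big_cons E.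
exists ('X * Q - k *: 'X^(size t) - (k * K) *: Q).
rewrite exprS -!mul_polyC !rmorphM /=; ring.
Qed.

(** Coefficient [j] of the derivative must be divisible by [j + 1]. Modulo [n!] the product over [t]
    is [X^(n-2)], so only degrees [n - 1] and [n - 2] matter; their coefficients are [n] and [-m]
    modulo [n!]. *)
Lemma integral_antiderivative (n : nat) (t : seq int) (m : int) : (1 < n)%N ->
  size t = n.-2 -> all (fun x : int => (n`!%:Z %| x)%Z) t -> (n.-1 %| m)%Z ->
  exists P : {poly int}, [/\ P \is monic, size P = n.+1, P`_0 = 0 &
    P^`() = (n%:Z *: 'X - m%:P) * \prod_(x <- t) ('X - x%:P)].
Proof.
move=> n1 szt dt dm; have [Q EQ] := prod_XsubC_mod dt.
set E := _ * _.
have szprod : size (\prod_(x <- t) ('X - x%:P)) = n.-1.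
  by rewrite size_prod_XsubC szt; lia.
have coefE' j : E`_j = (if j is i.+1 then n%:Z * (\prod_(x <- t) ('X - x%:P))`_i else 0)
     - m * (\prod_(x <- t) ('X - x%:P))`_j.
  rewrite /E mulrBl coefB mul_polyC coefZ -scalerAl coefZ coefXM.
  by case: j => [|j] //=; rewrite mulr0.
have lastc : (\prod_(x <- t) ('X - x%:P))`_n.-2 = 1.
  have /monicP := monic_prod_XsubC t xpredT id.
  by rewrite lead_coefE szprod.
have En : E`_n.-1 = n.
  rewrite coefE'; case: n n1 szt szprod lastc {dt dm EQ E coefE'} => [|[|n]] //= _ _ szp ->.
  by rewrite mulr1 (nth_default 0) ?mulr0 ?subr0 // szp.
have Ebig j : (n <= j)%N -> E`_j = 0.
  move=> nj; rewrite coefE' [X in m * X]nth_default ?mulr0 ?subr0; last first.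
    by rewrite szprod; lia.
  by case: j nj => // j nj; rewrite nth_default ?mulr0 // szprod; lia.
have dE j : (j.+1%:Z %| E`_j)%Z.
  case: (ltnP j n) => jn; last by rewrite Ebig.
  have jf : (j.+1%:Z %| n`!%:Z)%Z.
    by rewrite /dvdz /=; apply: dvdn_fact; rewrite jn.
  have [->|jn1] := eqVneq j n.-1; first by rewrite En prednK // ltnW.
  rewrite coefE' EQ szt; apply: rpredB.
    case: j jn jf jn1 => // j jn jf jn1; apply: dvdz_mull; rewrite coefD coefXn coefZ.
    rewrite (_ : j == n.-2 = false) ?add0r ?dvdz_mulr //; apply/eqP; lia.
  rewrite coefD coefXn coefZ; have [jE|_] := eqVneq j n.-2.
    by apply: dvdz_mulr; rewrite jE (_ : n.-2.+1 = n.-1) //; lia.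
  by rewrite add0r; apply: dvdz_mull; apply: dvdz_mulr.
pose P : {poly int} := \poly_(j < n.+1) (if j == 0%N then 0 else (E`_j.-1 %/ j%:Z)%Z).
have Pn : P`_n = 1.
  rewrite /P coef_poly ltnSn En (_ : n == 0%N = false) ?divzz; last by lia.
  by rewrite eqz_nat (_ : n == 0%N = false) //; lia.
have szP : size P = n.+1.
  by apply: size_poly_eq; move: Pn; rewrite /P coef_poly ltnSn => ->.
exists P; split => //.
- by rewrite monicE lead_coefE szP Pn.
- by rewrite /P coef_poly.
- apply/polyP => j; rewrite coef_deriv /P coef_poly ltnS.
  case: ltnP => jn; last by rewrite mul0rn Ebig.
  by rewrite -mulr_natr natz divzK.
Qed.

Lemma critical_data_exists (n : nat) : (1 < n)%N ->
  exists P s alpha beta, critical_data n P s alpha beta.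
Proof.
move=> n1; have n0 : (0 < n)%N by apply: ltnW.
have nQ : n%:R != 0 :> rat by rewrite pnatr_eq0 -lt0n.
have [t [szt dt spt]] := spiral_int_exists rat n.-2 (fact_gt0 n).
have [A HA] := spiral_rcons spt.
(* The last point is [(n - 1) / n + (n - 1) u = m / n] with [m = (n - 1) (n u + 1)], a multiple of
   [n - 1] congruent to [-1] modulo [n]. *)
have [||u Hu] := @eventually_ge_natmul rat (fun a => spiral (rcons (map intr t) (n.-1%:R / n%:R + a))) n.-1%:R.
- by rewrite ltr0n; lia.
- exists A => a Aa; apply: HA; apply: le_trans Aa _.
  by rewrite lerDr divr_ge0 ?ler0n.
set a := (_ + _) in Hu; pose m := (n.-1 * (n * u).+1)%N.
have aE : a = m%:R / n%:R.
  by rewrite /a /m natrM -natr1 natrM; field.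
have [|P [Pm szP P0 dP]] := @integral_antiderivative n t m n1 szt dt.
  by rewrite /m PoszM dvdz_mulr.
set ss := rcons _ a in Hu; pose s i := ss`_i; pose N := n.-1.
have szss : size ss = N by rewrite size_rcons size_map szt /N; lia.
have dPss : (map_poly toQ P)^`() = n%:R *: \prod_(x <- ss) ('X - x%:P).
  rewrite deriv_map dP rmorphM rmorph_prod /= rmorphB /= map_polyZ map_polyX map_polyC /=.
  have -> : (n%:Z%:~R *: 'X - (m%:Z%:~R)%:P) = n%:R *: ('X - a%:P) :> {poly rat}.
    by rewrite scalerBr -[n%:R *: _%:P]mul_polyC -polyCM aE mulrC divfK.
  rewrite /ss big_rcons /= big_map -scalerAl mulrC; congr (_ *: (_ * _)).
  by apply: eq_bigr => x _; rewrite rmorphB /= map_polyX map_polyC.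
have cE : crit_poly ss = ((-1) ^+ N / n%:R) *: map_poly toQ P.
  apply: antideriv_unique; last by rewrite coefZ coef_map /= P0 mulr0.
  rewrite derivZ dPss scalerA mulfVK //.
  rewrite -szss; elim: (ss) => [|x l IH]; first by rewrite !big_nil scale1r.
  rewrite !big_cons -IH /= exprS -!mul_polyC !rmorphM /= rmorphN1; ring.
have hP i : (i < N)%N -> (-1) ^+ (N - i) * (map_poly toQ P).[s i] = n%:R * crit_height ss i.
  move=> iN; rewrite /crit_height cE hornerZ -/(s i).
  have -> : (-1) ^+ (N - i) = (-1) ^+ i * (-1) ^+ N :> rat.
    by rewrite -exprD -signr_odd -[in RHS]signr_odd oddB ?(ltnW iN) // oddD addbC.
  by field.
case: Hu => Hu1 Hu2 Hu3 Hu4; rewrite szss in Hu1 Hu2 Hu3 Hu4.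
have habs i : (i < N)%N -> `|(map_poly toQ P).[s i]| = n%:R * crit_height ss i.
  move=> iN; rewrite -(normrMsign (N - i)) hP // ger0_norm //.
  by rewrite mulr_ge0 ?ler0n // ltW // Hu3.
(* Integral points have integral values; at [m / n] the denominator [n ^ n] is cleared by scaling
   with [T = n]. *)
pose al i : int := if (i < n.-2)%N then 1 else n%:Z ^+ n.
pose be i : int := if (i < n.-2)%N then P.[t`_i] else (scale_poly n n%:Z P).[m%:Z].
have sl i : (i < n.-2)%N -> s i = (t`_i)%:~R.
  by move=> h; rewrite /s nth_rcons size_map szt h (nth_map 0) ?szt.
have sL : s n.-2 = a by rewrite /s nth_rcons size_map szt ltnn eqxx.
exists P, s, al, be; split => //.
- by rewrite dPss (big_nth 0) szss big_mkord.
- by move=> i iN; rewrite hP // mulr_gt0 ?ltr0n // Hu3.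
- move=> i j /andP[ij jN]; rewrite !habs ?(ltn_trans ij jN) //.
  by rewrite ltr_pM2l ?ltr0n // Hu4 // ij.
- move=> i iN; rewrite /al /be; case: ltnP => h; first by rewrite sl // horner_map divr1.
  have -> : i = n.-2 by lia.
  have E : m%:Z%:~R = n%:Z%:~R * a :> rat by rewrite aE !pmulrn mulrC divfK.
  rewrite sL -horner_map /= E horner_scale_poly // rmorphXn /= mulrC mulKf //.
  by rewrite expf_neq0 // -pmulrn.
- by move=> i; rewrite /al; case: ifP => // _; rewrite exprn_gt0 // ltz_nat.
- have -> : n.-1 = n.-2.+1 by lia.
  rewrite big_ord_recr /= big1 ?mul1r; last by move=> i _; rewrite /al ltn_ord.
  by rewrite /al ltnn.
(* At an integral point, [p] divides the point and [P(0) = 0], so [p] divides the value. At [m / n]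
   the numerator is [m ^ n] modulo [p], and [m] is prime to [n]. *)
- move=> p i pp pn iN; rewrite /al /be; case: ltnP => h.
    have p1 : (p %| 1)%Z = false.
      by rewrite dvdzE absz1 dvdn1; apply/negbTE; rewrite neq_ltn prime_gt1 ?orbT.
    rewrite p1 /=.
    have ti : (p %| t`_i)%Z.
      apply: dvdz_trans (allP dt _ (mem_nth 0 _)); rewrite ?szt //.
      by rewrite /dvdz /=; apply: dvdn_trans pn _; apply: dvdn_fact; rewrite n0 leqnn.
    have [Q ->] : exists Q, P = Q * ('X - 0%:P).
      by apply/factor_theorem; rewrite /root horner_coef0 P0.
    by rewrite hornerM hornerXsubC subr0 dvdz_mull.
  have -> : (p %| n%:Z ^+ n)%Z.
    by rewrite dvdzE abszX Euclid_dvdX //= pn n0.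
  have [Q ->] := scale_poly_mod Pm szP n%:Z.
  rewrite addTb hornerD hornerZ hornerXn rpredDr; last first.
    by rewrite dvdz_mulr.
  rewrite dvdzE abszX Euclid_dvdX // n0 andbT /= /m Euclid_dvdM // negb_or.
  have p1 : ~~ (p %| 1)%N by rewrite dvdn1; apply/eqP => p1; rewrite p1 in pp.
  rewrite -(prednK n0) -addn1 in pn.
  apply/andP; split.
    by apply: contra p1 => d; rewrite -(dvdn_addr _ d).
  apply: contra p1 => d; rewrite -(@dvdn_addr (n * u)) ?addn1 //.
  by apply: dvdn_mulr; rewrite -(prednK n0) -addn1.
Qed.

(** * The sieve *)

(** The interval is cut into blocks of length at most [d], each meeting the residue class at most
    once. *)
Lemma count_congruent_le (P : pred nat) (d t0 X : nat) : (0 < d)%N ->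
  (forall t t', P t -> P t' -> t = t' %[mod d]) ->
  (count P (iota t0 X) <= (X %/ d).+1)%N.
Proof.
move=> d0 hP; have small x Y : (Y <= d)%N -> (count P (iota x Y) <= 1)%N.
  move=> Yd; rewrite -size_filter.
  have us : uniq (filter P (iota x Y)) by rewrite filter_uniq ?iota_uniq.
  case E : (filter _ _) us => [|a [|b l]] //= /andP[].
  rewrite inE negb_or => /andP[/eqP ab _] _; case: ab.
  have mem c : c \in [:: a, b & l] -> P c /\ (x <= c < x + Y)%N.
    by rewrite -E mem_filter mem_iota => /andP[].
  have [Pa ra] := mem a (mem_head _ _).
  have [|Pb rb] := mem b; first by rewrite !inE eqxx orbT.
  have ab := hP _ _ Pa Pb.
  have key u v : (u <= v < u + d)%N -> u = v %[mod d] -> u = v.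
    move=> uv /eqP; rewrite eq_sym eqn_mod_dvd; last by case/andP: uv.
    by move=> /dvdnP[[|k] hk]; lia || nia.
  case: (leqP a b) => h; [apply: (key a b) => //|apply/esym; apply: (key b a) => //]; lia.
elim/ltn_ind: X t0 => X IH t0; case: (leqP X d) => Xd.
  by apply: leq_trans (small _ _ Xd) _.
have E : X = (d + (X - d))%N by lia.
have lt : (X - d < X)%N by lia.
rewrite {1}E iotaD count_cat.
apply: leq_trans (leq_add (small _ _ (leqnn d)) (IH _ lt _)) _.
have -> : (X %/ d = 1 + (X - d) %/ d)%N by rewrite {1}E divnDl ?dvdnn // divnn d0.
by [].
Qed.

(** Telescoping of [1 / (q + 1)^2 <= 1 / q - 1 / (q + 1)]. *)
Lemma sum_inv_squares_le (X y Z : nat) : (0 < y <= Z)%N ->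
  (\sum_(y <= q < Z) (X %/ q.+1 ^ 2)%N)%:R <= X%:R / y%:R - X%:R / Z%:R :> rat.
Proof.
move=> /andP[y0 yZ]; elim: Z yZ => [|Z IH]; first by rewrite leqn0 => /eqP y0'; rewrite y0' in y0.
rewrite leq_eqVlt => /orP[/eqP <-|]; first by rewrite big_geq // subrr.
rewrite ltnS => yZ; rewrite big_nat_recr //= natrD.
have Z0 : 0 < Z%:R :> rat by rewrite ltr0n; lia.
have Z1 : 0 < Z.+1%:R :> rat by rewrite ltr0n.
have X0 : 0 <= X%:R :> rat by rewrite ler0n.
have h1 : (X %/ Z.+1 ^ 2)%:R <= X%:R / Z%:R - X%:R / Z.+1%:R :> rat.
  apply: (@le_trans _ _ (X%:R / (Z.+1%:R ^+ 2))).
    by rewrite ler_pdivlMr ?exprn_gt0 // -natrX -natrM ler_nat leq_trunc_div.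
  rewrite -mulrBr ler_wpM2l //.
  have -> : Z%:R^-1 - Z.+1%:R^-1 = (Z%:R * Z.+1%:R)^-1 :> rat.
    have zz : Z.+1%:R = Z%:R + 1 :> rat by rewrite -natr1.
    by rewrite zz in Z1 *; field; rewrite !gt_eqF.
  rewrite lef_pV2 ?posrE ?mulr_gt0 ?exprn_gt0 // expr2 ler_wpM2r ?ltW //.
  by rewrite ltr_nat.
by apply: le_trans (lerD (IH yZ) h1) _; rewrite addrA subrK.
Qed.

Lemma count_has_le (T I : Type) (r : seq I) (F : I -> pred T) (l : seq T) :
  (count (fun t => has (fun i => F i t) r) l <= \sum_(i <- r) count (F i) l)%N.
Proof.
elim: r => [|i r IH]; first by rewrite big_nil /= count_pred0.
rewrite big_cons; apply: leq_trans (leq_add (leqnn _) IH).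
by rewrite -count_predUI; apply: leq_trans (leq_addr _ _).
Qed.

(** Since no two forms share a prime outside [M], a square [p ^ 2] dividing the product divides a
    single form, and then [y < p <= Z]. Each such [p] excludes one class modulo [p ^ 2] per form, in
    all at most half of the [X] values. *)
Lemma squarefree_sieve (h X t0 Z y M : nat) (L : nat -> nat -> int) :
  (forall p i t, prime p -> (p %| M)%N -> (i < h)%N -> ~~ (p %| L i t)%Z) ->
  (forall p, prime p -> ~~ (p %| M)%N -> (y < p)%N) ->
  (forall p i t t', prime p -> ~~ (p %| M)%N -> (i < h)%N ->
     ((p ^ 2)%N %| L i t)%Z -> ((p ^ 2)%N %| L i t')%Z -> (t = t' %[mod p ^ 2])%N) ->
  (forall p i j t, prime p -> ~~ (p %| M)%N -> (i < j < h)%N ->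
     ~~ ((p %| L i t)%Z && (p %| L j t)%Z)) ->
  (forall i t, (i < h)%N -> (t0 <= t < t0 + X)%N -> L i t != 0 /\ (`|L i t| <= Z ^ 2)%N) ->
  (0 < h)%N -> (4 * h <= y)%N -> (y <= Z)%N -> (4 * h * Z <= X)%N ->
  exists D : seq nat,
    [/\ uniq D, (X <= 2 * size D)%N, (forall t, t \in D -> (t0 <= t < t0 + X)%N) &
        forall t, t \in D -> sqfree_int (\prod_(i < h) L i t)].
Proof.
move=> H1 H2 H3 H4 H5 h0 hy yZ hX.
(* The prime is [q.+1], so that [q] in [[y, Z)] covers [y < p <= Z]. *)
pose bad i q t := [&& prime q.+1, ~~ (q.+1 %| M)%N & ((q.+1 ^ 2)%N %| L i t)%Z].
pose isbad t := has (fun i => has (fun q => bad i q t) (index_iota y Z)) (iota 0 h).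
pose D := [seq t <- iota t0 X | ~~ isbad t].
exists D; split.
- by rewrite filter_uniq ?iota_uniq.
- have cnt : (count isbad (iota t0 X) <= \sum_(0 <= i < h) \sum_(y <= q < Z) (X %/ q.+1 ^ 2).+1)%N.
    apply: (@leq_trans (\sum_(0 <= i < h) \sum_(y <= q < Z) count (bad i q) (iota t0 X))%N).
      apply: leq_trans (count_has_le _ _ _) _; rewrite /index_iota subn0.
      by apply: leq_sum => i _; apply: count_has_le.
    rewrite big_nat [X in (_ <= X)%N]big_nat; apply: leq_sum => i /andP[_ ih]; apply: leq_sum => q _.
    case: (boolP (prime q.+1)) => pq; last first.
      by rewrite (eq_count (a2 := pred0)) ?count_pred0 // => t; rewrite /bad (negPf pq).
    case: (boolP (q.+1 %| M)%N) => qM.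
      by rewrite (eq_count (a2 := pred0)) ?count_pred0 // => t; rewrite /bad qM andbF.
    apply: count_congruent_le; first by rewrite expn_gt0.
    by move=> t t' /and3P[_ _ b1] /and3P[_ _ b2]; apply: H3 b1 b2.
  rewrite sum_nat_const_nat subn0 in cnt.
  (* The quotients add up to at most [X / y <= X / (4 h)], the extra ones to at most
     [Z <= X / (4 h)]. *)
  have S : ((\sum_(y <= q < Z) (X %/ q.+1 ^ 2).+1) * (2 * h) <= X)%N.
    have y0 : (0 < y)%N by lia.
    have := @sum_inv_squares_le X y Z; rewrite y0 yZ => /(_ isT) Sb.
    have -> : (\sum_(y <= q < Z) (X %/ q.+1 ^ 2).+1 = \sum_(y <= q < Z) (X %/ q.+1 ^ 2) + (Z - y))%N.
      under eq_bigr do rewrite -addn1.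
      by rewrite big_split /= sum_nat_const_nat muln1.
    move: Sb; set S := (\sum_(y <= q < Z) _)%N => Sb.
    have Sy : (S * y <= X)%N.
      rewrite -(ler_nat rat) natrM -ler_pdivlMr ?ltr0n //; apply: le_trans Sb _.
      by rewrite lerBlDr lerDl divr_ge0 ?ler0n.
    nia.
  have : (count isbad (iota t0 X) + size D = X)%N.
    by rewrite size_filter count_predC size_iota.
  lia.
- by move=> t; rewrite mem_filter mem_iota => /andP[].
move=> t; rewrite mem_filter mem_iota => /andP[nb rt]; split.
  by apply/prodf_neq0 => i _; have [] := H5 i t (ltn_ord i) rt.
move=> p pp; apply/negP => dv.
have absP : absz (\prod_(i < h) L i t) = (\prod_(i < h) absz (L i t))%N.
  by apply: (big_morph absz abszM).
rewrite absP in dv.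
have [i pi] : exists i : 'I_h, (p %| `|L i t|)%N.
  have : (p %| \prod_(i < h) `|L i t|)%N by apply: dvdn_trans dv; rewrite dvdn_mulr.
  by rewrite Euclid_dvd_prod // big_orE => /existsP[i /= pi]; exists i.
case: (boolP (p %| M)%N) => pM.
  by have := H1 p i t pp pM (ltn_ord i); rewrite dvdzE /= pi.
have p2 : (p ^ 2 %| `|L i t|)%N.
  rewrite (bigD1 i) //= Gauss_dvdl // in dv.

  rewrite coprimeMl andbb prime_coprime // Euclid_dvd_prod // big_orE; apply/existsPn => j /=.
  apply/negP => /andP[ji pj].
  have := H4 p _ _ t pp pM; move: ji; rewrite -val_eqE /= neq_ltn => /orP[] lt.
    by move=> /(_ j i); rewrite lt ltn_ord !dvdzE /= pi pj => /(_ isT).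
  by move=> /(_ i j); rewrite lt ltn_ord !dvdzE /= pi pj => /(_ isT).
have [L0 LZ] := H5 i t (ltn_ord i) rt.
have pZ : (p <= Z)%N.
  have : (p ^ 2 <= Z ^ 2)%N by apply: leq_trans (dvdn_leq _ p2) LZ; rewrite absz_gt0.
  by rewrite leq_exp2r.
have yp := H2 p pp pM.
case/negP: nb; apply/hasP; exists (val i); first by rewrite mem_iota /= add0n ltn_ord.
apply/hasP; exists p.-1.
  by rewrite mem_index_iota; move: yp pZ (prime_gt0 pp); clear; lia.
by rewrite /bad prednK ?prime_gt0 // pp pM dvdzE.
Qed.

(** * Assembling the family *)

(** Each critical value is [T ^+ n] times one of [P], plus [c]. The first [2 * s] are made positive
    by [c]; the others keep their sign. Modulo [l] the polynomial becomes [X^n - g]. *)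
Lemma good_scale_poly (n s : nat) (S : seq nat) P sp al be (l : nat) (g : 'F_l) (T c : int) :
  (1 < n)%N -> (2 * s <= n)%N -> critical_data n P sp al be ->
  prime l -> (l.-1).-primitive_root g -> (n %| l.-1)%N ->
  (l %| T)%Z -> 0 < T -> c%:~R = - g ->
  (forall i, (i < n.-1)%N -> (i < 2 * s)%N -> T%:~R ^+ n * `|(map_poly toQ P).[sp i]| < c%:~R) ->
  (forall i, (i < n.-1)%N -> (2 * s <= i)%N -> c%:~R < T%:~R ^+ n * `|(map_poly toQ P).[sp i]|) ->
  0 < c ->
  let F := \prod_(i < n.-1) (al i * c + T ^+ n * be i) in
  sqfree_int F -> (forall p, p \in S -> ~~ (p %| `|F|)%N) ->
  good_poly n (n - 2 * s) S (scale_poly n T P + c%:P) /\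
  discC (scale_poly n T P + c%:P) = ((-1) ^+ disc_sign n * F)%:~R.
Proof.
move=> n1 sn cd pl pg nl lT T0 cg R1 R2 c0 F sqF SF.
have n0 : (0 < n)%N by apply: ltnW.
have [Pm szP] := (cd_monic cd, cd_size cd).
have [fm szf] := size_scale_polyD Pm szP T c n0.
set f := _ + _ in fm szf *.
have TQ : 0 < T%:~R :> rat by rewrite ltr0z.
have TN : 0 < T%:~R ^+ n :> rat by rewrite exprn_gt0.
have df := @deriv_scale_poly n P szP T c sp (lt0r_neq0 T0) n0 (cd_deriv cd).
rewrite -/f in df.
have fval i : (map_poly toQ f).[T%:~R * sp i] = T%:~R ^+ n * (map_poly toQ P).[sp i] + c%:~R.
  by rewrite /f rmorphD /= map_polyC hornerD hornerC horner_scale_poly.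
have nE : n = n.-1.+1 by rewrite prednK.
have disc : discC f = ((-1) ^+ disc_sign n * F)%:~R.
  have := @discC_critical f (fun i => ratr (T%:~R * sp i)) n.-1 fm.
  rewrite -nE szf => /(_ erefl) ->; last first.
    have fC : map_poly (intr : int -> algC) f = map_poly (ratr : rat -> algC) (map_poly toQ f).
      by rewrite -map_poly_comp; apply: eq_map_poly => x /=; rewrite ratr_int.
    rewrite fC deriv_map df map_polyZ rmorph_prod /= rmorph_nat; congr (_ *: _).
    by apply: eq_bigr => i _; rewrite rmorphB /= map_polyX map_polyC.
  have -> : \prod_(i < n.-1) (map_poly (intr : int -> algC) f).[ratr (T%:~R * sp i)] =
      ratr (\prod_(i < n.-1) (map_poly toQ f).[T%:~R * sp i]).
    rewrite rmorph_prod; apply: eq_bigr => i _; rewrite -horner_map -map_poly_comp /=.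
    by congr (_.[_]); apply: eq_map_poly => x /=; rewrite ratr_int.
  rewrite [in RHS]rmorphM rmorph_sign /= -mulrA; congr (_ * _); rewrite -[RHS]ratr_int.
  rewrite -[n%:R](ratr_nat algC) -rmorphXn -rmorphM /=; congr ratr.
  have -> : n%:R ^+ n = (\prod_(i < n.-1) al i)%:~R :> rat.
    by rewrite (cd_prod cd) rmorphXn.
  rewrite /F !rmorph_prod -big_split /=; apply: eq_bigr => i _.
  rewrite fval (cd_val cd) // rmorphD !rmorphM rmorphXn /=.
  have : (al i)%:~R != 0 :> rat by rewrite intr_eq0 lt0r_neq0 // (cd_pos cd).
  by move=> a0; field.
split=> //; split=> //.
- apply: (@irreducible_mod_Xn_sub_prim f l n g) => //.
  have [Q EQ] := scale_poly_mod Pm szP T.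
  rewrite /f EQ !rmorphD /= map_polyXn map_polyC /= cg polyCN map_polyZ /=.
  have -> : T%:~R = 0 :> 'F_l.
    case/dvdzP: lT => k ->; rewrite rmorphM /= -pmulrn.
    by have := pcharf0 (pchar_Fp pl) => ->; rewrite mulr0.
  by rewrite scale0r addr0.
- rewrite [n in (n - _)%N]nE.
  apply: (@nreal_roots_critical f (fun i => T%:~R * sp i) n.-1 s n%:R); rewrite -?nE //.
  + lia.
  + by rewrite pnatr_eq0 -lt0n.
  + by move=> i j ij; rewrite ltr_pM2l // (cd_incr cd).
  + move=> i is2 iN; rewrite fval; have := R1 i iN is2.
    have := ler_norm (- (map_poly toQ P).[sp i]); rewrite normrN => h1 h2.
    have : T%:~R ^+ n * - (map_poly toQ P).[sp i] <= T%:~R ^+ n * `|(map_poly toQ P).[sp i]|.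
      by rewrite ler_wpM2l // ltW.
    rewrite mulrN; lra.
  + move=> i is2 iN; rewrite fval mulrDr mulrCA.
    have := R2 i iN is2; have sg := cd_sign cd iN.
    rewrite -(normrMsign (n.-1 - i)) gtr0_norm // => h.
    have : - c%:~R <= (-1) ^+ (n.-1 - i) * c%:~R :> rat.
      have cQ : 0 < c%:~R :> rat by rewrite ltr0z.
      rewrite -signr_odd; case: (odd _); rewrite ?expr1 ?expr0; lra.
    lra.
- exists ((-1) ^+ disc_sign n * F); split => //; split.
    case: sqF => F0 sqF; split; first by rewrite mulf_neq0 // signr_eq0.
    by move=> p pp; rewrite abszMsign; apply: sqF.
  by move=> p pS; rewrite abszMsign; apply: SF.
Qed.

(* These cross products are the resultants of the linear forms giving the discriminant. *)
Lemma critical_cross_neq0 n P sp al be i j : critical_data n P sp al be ->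
  (i < n.-1)%N -> (j < n.-1)%N -> i != j -> al i * be j - al j * be i != 0.
Proof.
move=> cd; wlog ij : i j / (i < j)%N => [hw iN jN|iN jN _].
  rewrite neq_ltn => /orP[] ij; first by rewrite hw // neq_ltn ij.
  by rewrite -oppr_eq0 opprB hw // neq_ltn ij.
have := cd_grow cd (i := i) (j := j); rewrite ij jN => /(_ isT).
apply: contraTneq => /eqP; rewrite subr_eq0 => /eqP E.
rewrite !(cd_val cd) // -leNgt le_eqVlt; apply/orP; left; apply/eqP; congr `|_|.
have ai : (al i)%:~R != 0 :> rat by rewrite intr_eq0 lt0r_neq0 // (cd_pos cd).
have aj : (al j)%:~R != 0 :> rat by rewrite intr_eq0 lt0r_neq0 // (cd_pos cd).
apply: (mulfI ai); apply: (mulfI aj).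
have := congr1 (intr : int -> rat) E; rewrite !rmorphM /= => E'.
transitivity ((al i)%:~R * (be j)%:~R : rat); first by field.
by rewrite E'; field.
Qed.

Lemma critical_alpha_prime n P sp al be p i : critical_data n P sp al be ->
  prime p -> ~~ (p %| n)%N -> (i < n.-1)%N -> ~~ (p %| al i)%Z.
Proof.
move=> cd pp pn iN; apply: contra pn => pi.
have : (p %| (n%:Z ^+ n)%R)%Z.
  rewrite -(cd_prod cd) (bigD1 (Ordinal iN)) //=; exact: dvdz_mulr.
by rewrite dvdzE abszX Euclid_dvdX //= => /andP[].
Qed.

(* [D] collects the primes, prime to [n], that are at most [y], or in [S], or equal to [l], or
   divide a resultant of two linear forms. *)
Lemma bad_prime_modulus n P sp al be (y : nat) (S : seq nat) (l : nat) (g : 'F_l) :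
  (1 < n)%N -> critical_data n P sp al be -> all prime S ->
  prime l -> ~~ (l %| n)%N -> g != 0 ->
  exists D c0 : nat,
    [/\ (0 < D)%N && (l %| D)%N, forall p, prime p -> (p %| D)%N -> ~~ (p %| n)%N,
        coprime c0 (n * D), c0%:R = - g &
        forall p, prime p -> ~~ (p %| n * D)%N ->
          [/\ (y < p)%N, p \notin S & forall i j, (i < n.-1)%N -> (j < n.-1)%N -> i != j ->
            ~~ (p %| (al i * be j - al j * be i)%R)%Z]].
Proof.
move=> n1 cd Sp pl ln g0.
have n0 : (0 < n)%N by apply: ltnW.
pose cross (i j : nat) : nat := absz (al i * be j - al j * be i)%R.
pose D0 := (y`! * (\prod_(p <- S) p) * l * \prod_(i < n.-1) \prod_(j < n.-1 | j != i) cross i j)%N.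
have cr0 (i j : 'I_n.-1) : j != i -> (0 < cross i j)%N.
  by move=> ji; rewrite absz_gt0 (critical_cross_neq0 cd) // eq_sym.
have D00 : (0 < D0)%N.
  rewrite /D0 !muln_gt0 fact_gt0 (prime_gt0 pl) /= andbT; apply/andP; split.
    by rewrite big_seq; apply: prodn_cond_gt0 => p /(allP Sp) /prime_gt0.
  by apply: prodn_gt0 => i; apply: prodn_cond_gt0 => j /cr0.
(* Only the part prime to [n] is kept: at the primes of [n] the forms are controlled by [cd_xor]. *)
pose D := (D0`_(\pi(n)^'))%N.
have pD p : prime p -> (p %| D)%N = ~~ (p %| n)%N && (p %| D0)%N.
  move=> pp; have := primes_part (\pi(n)^') D0 => /(congr1 (fun s => p \in s)).
  rewrite mem_filter !mem_primes pp part_gt0 D00 /= => ->.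
  by rewrite !inE /= mem_primes pp n0.
have D_gt0 : (0 < D)%N by rewrite part_gt0.
have M0 : (0 < n * D)%N by rewrite muln_gt0 n0.
have lD : (l %| D)%N by rewrite pD // ln /D0 dvdn_mulr // dvdn_mull.
pose M' := ((n * D)`_(l^'))%N.
have coM' : coprime l M'.
  by rewrite prime_coprime // -p'natE // part_pnat.
(* The residue [-g] modulo [l] is for irreducibility; the residue 1 keeps [c0] prime to the other
   primes of [n * D]. *)
pose c0 := chinese l M' (val (- g)) 1.
have c0g : c0%:R = - g.
  by rewrite -Fp_nat_mod // /c0 chinese_modl // Fp_nat_mod // natr_Zp.
exists D, c0; split => //; first by rewrite D_gt0.
- by move=> p pp; rewrite pD // => /andP[].
- apply/negPn/negP => ncop.
  have g1 : (1 < gcdn c0 (n * D))%N.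
    have : (0 < gcdn c0 (n * D))%N by rewrite gcdn_gt0 M0 orbT.
    by move: ncop; rewrite /coprime; case: (gcdn _ _) => [|[]].
  have [p pp] := pdivP g1; rewrite dvdn_gcd => /andP[pc pM].
  have [pl'|pl'] := eqVneq p l.
    move: pc; rewrite pl' (dvdn_pcharf (pchar_Fp pl)) c0g oppr_eq0; exact/negP.
  have pM' : (p %| M')%N.
    have := primes_part (l^') (n * D) => /(congr1 (fun s => p \in s)).
    by rewrite mem_filter !mem_primes pp part_gt0 M0 pM /= !inE pl'.
  have := chinese_modr coM' (val (- g)) 1; rewrite -/c0 => E.
  have := modn_dvdm c0 pM'; rewrite E modn_dvdm // (modn_small (prime_gt1 pp)).
  by move/eqP: pc => ->.
move=> p pp pM.
have [pn pD'] : ~~ (p %| n)%N /\ ~~ (p %| D)%N by apply/andP; rewrite -negb_or -Euclid_dvdM.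
have pD0 : ~~ (p %| D0)%N by move: pD'; rewrite pD // pn.
split.
- rewrite ltnNge; apply: contra pD0 => py; rewrite /D0 -!mulnA dvdn_mulr //.
  by rewrite dvdn_fact // prime_gt0.
- apply: contra pD0 => pS; rewrite /D0 (big_rem _ pS) /= -!mulnA dvdn_mull // dvdn_mulr //.
- move=> i j iN jN ij; apply: contra pD0 => pc; rewrite /D0 dvdn_mull //.
  rewrite (bigD1 (Ordinal iN)) //= dvdn_mulr // (bigD1 (Ordinal jN)) /=; last first.
    by rewrite -val_eqE /= eq_sym.
  by rewrite dvdn_mulr.
Qed.

(** * Divisibility of the linear forms by primes *)

Section Forms.
Variables (n : nat) (P : {poly int}) (sp : nat -> rat) (al be : nat -> int) (D c0 : nat).
Hypotheses (n1 : (1 < n)%N) (cd : critical_data n P sp al be).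
Hypotheses (Dn : forall p, prime p -> (p %| D)%N -> ~~ (p %| n)%N) (co : coprime c0 (n * D)).

(** Write [c] for [c0 + n * D * t], which is prime to [p]. If [p] divides [D], it divides [T] but
    not [al i]. If [p] divides [n], it is prime to [T], and by [cd_xor] it divides exactly one of
    the two terms. *)
Lemma form_unit (T t i p : nat) : prime p -> (p %| n * D)%N -> (i < n.-1)%N ->
  (forall q, prime q -> (q %| T)%N = (q %| D)%N) ->
  ~~ (p %| (al i * (c0 + n * D * t)%N + T%:Z ^+ n * be i)%R)%Z.
Proof.
move=> pp pM iN TD; have n0 : (0 < n)%N by apply: ltnW.
have pc : ~~ (p %| (c0 + n * D * t)%N%:Z)%Z.
  rewrite dvdzE /= (dvdn_addl _ (dvdn_mulr t pM)); apply/negP => pc0.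
  have : (p %| gcdn c0 (n * D))%N by rewrite dvdn_gcd pc0.
  by rewrite (eqP co) dvdn1; apply/negP; rewrite neq_ltn prime_gt1 ?orbT.
have EM x z : (p %| (x * z)%R)%Z = (p %| x)%Z || (p %| z)%Z.
  by rewrite !dvdzE abszM Euclid_dvdM.
have TE : (p %| (T%:Z ^+ n)%R)%Z = (p %| D)%N.
  by rewrite dvdzE abszX Euclid_dvdX //= n0 andbT TD.
case: (boolP (p %| D)%N) => pD.
  rewrite rpredDr ?EM ?TE ?pD // (negPf pc) orbF.
  by apply: (critical_alpha_prime cd) => //; apply: Dn.
have pn : (p %| n)%N by move: pM; rewrite Euclid_dvdM // (negPf pD) orbF.
have := cd_xor cd pp pn iN; case: (boolP (p %| al i)%Z) => pa /=.
  by move=> pb; rewrite rpredDl ?EM ?pa // TE (negPf pD).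
by move=> pb; rewrite rpredDr ?EM ?pb ?orbT // (negPf pa) (negPf pc).
Qed.

(** The two values differ by [al i * n * D * (t - t')], where [p] divides none of the first three
    factors. *)
Lemma form_congruent (W : int) (t t' i p : nat) : prime p -> ~~ (p %| n * D)%N -> (i < n.-1)%N ->
  ((p ^ 2)%N %| (al i * (c0 + n * D * t)%N + W * be i)%R)%Z ->
  ((p ^ 2)%N %| (al i * (c0 + n * D * t')%N + W * be i)%R)%Z -> (t = t' %[mod p ^ 2])%N.
Proof.
move=> pp pM iN d1 d2.
have [pn pD] : ~~ (p %| n)%N /\ ~~ (p %| D)%N by apply/andP; rewrite -negb_or -Euclid_dvdM.
have := rpredB d1 d2.
have -> : al i * (c0 + n * D * t)%N + W * be i - (al i * (c0 + n * D * t')%N + W * be i) =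
  al i * (n * D)%N * (t%:Z - t'%:Z) by rewrite !PoszD !PoszM; ring.
rewrite Gauss_dvdzr; last first.
  rewrite coprimezE /=.
  rewrite coprimeXl // prime_coprime // abszM Euclid_dvdM // negb_or pM andbT.
  by have := critical_alpha_prime cd pp pn iN; rewrite dvdzE.
by rewrite -eqz_mod_dvd !modz_nat => /eqP [].
Qed.

(** Eliminating [c0 + n * D * t] between the two forms leaves [T ^+ n] times their resultant. *)
Lemma form_coprime (T t i j p : nat) : prime p -> ~~ (p %| T)%N -> (0 < n)%N ->
  ~~ (p %| (al i * be j - al j * be i)%R)%Z ->
  ~~ ((p %| (al i * (c0 + n * D * t)%N + T%:Z ^+ n * be i)%R)%Z &&
      (p %| (al j * (c0 + n * D * t)%N + T%:Z ^+ n * be j)%R)%Z).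
Proof.
move=> pp pT n0 pc; apply/negP => /andP[d1 d2].
have := rpredB (dvdz_mull (al i) d2) (dvdz_mull (al j) d1).
set x := (_ + _)%N; have -> : al i * (al j * x + T%:Z ^+ n * be j) - al j * (al i * x + T%:Z ^+ n * be i) =
  T%:Z ^+ n * (al i * be j - al j * be i) by ring.
rewrite dvdzE abszM Euclid_dvdM // => /orP[]; last by rewrite dvdzE in pc; rewrite (negPf pc).
by rewrite abszX Euclid_dvdX //= (negPf pT).
Qed.

End Forms.

(** * Counting distinct discriminants *)

Lemma size_le_fibers (T U : eqType) (f : T -> U) (s : seq T) (N : nat) :
  (forall u, (count (fun t => f t == u) s <= N)%N) ->
  (size s <= N * size (undup (map f s)))%N.
Proof.
move=> hN; have := count_has_le (undup (map f s)) (fun u t => f t == u) s.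
rewrite (@eq_in_count _ _ predT) ?count_predT => [h|t ts]; last first.
  by apply/hasP; exists (f t); rewrite ?mem_undup ?map_f /=.
apply: leq_trans h _.
elim: (undup _) => [|u r IH]; first by rewrite big_nil.
by rewrite big_cons /= mulnS leq_add.
Qed.

(** The solutions [t] are roots of a polynomial of degree [N]. *)
Lemma linear_product_fiber (N : nat) (a b : nat -> int) (d : int) (ts : seq nat) :
  (0 < N)%N -> (forall i, a i != 0) -> uniq ts ->
  (count (fun t : nat => (\prod_(i < N) (a i * t%:Z + b i) == d)%R) ts <= N)%N.
Proof.
move=> N0 a0 uts.
pose Q := \prod_(i < N) (a i *: 'X + (b i)%:P : {poly int}).
have sz1 i : size (a i *: 'X + (b i)%:P : {poly int}) = 2%N.
  rewrite size_polyDl ?size_scale ?size_polyX //.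
  exact: leq_ltn_trans (size_polyC_leq1 _) _.
have szQ : size Q = N.+1.
  rewrite size_prod => [|i _]; last by rewrite -size_poly_gt0 sz1.
  rewrite (eq_bigr (fun=> 2%N)) => [|i _]; last exact: sz1.
  by rewrite sum_nat_const cardT size_enum_ord; lia.
have szd : (size (- d%:P : {poly int}) < size Q)%N.
  by rewrite szQ size_polyN; apply: leq_ltn_trans (size_polyC_leq1 _) _.
have szq : size (Q - d%:P) = N.+1 by rewrite size_polyDl.
rewrite -size_filter -ltnS -szq -(size_map Posz); apply: max_poly_roots.
- by rewrite -size_poly_gt0 szq.
- apply/allP => x /mapP[t tf ->]; move: tf; rewrite mem_filter => /andP[/eqP E _].
  rewrite /root hornerD hornerN hornerC /Q horner_prod -E subr_eq0; apply/eqP.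
  by apply: eq_bigr => i _; rewrite hornerD hornerZ hornerX hornerC.
- by rewrite map_inj_uniq ?filter_uniq // => x y [].
Qed.

(** The ratio [c / T ^+ n] will be taken strictly between [u] and [v], which separate the first
    [2 * s] heights from the rest. *)
Lemma height_window n P sp al be s : (1 < n)%N -> critical_data n P sp al be ->
  exists u v : rat, [/\ 0 <= u, u < v,
    forall i, (i < n.-1)%N -> (i < 2 * s)%N -> `|(map_poly toQ P).[sp i]| <= u &
    forall i, (i < n.-1)%N -> (2 * s <= i)%N -> v <= `|(map_poly toQ P).[sp i]| ].
Proof.
move=> n1 cd; pose w i := `|(map_poly toQ P).[sp i]|.
have wmono i j : (i <= j < n.-1)%N -> w i <= w j.
  rewrite leq_eqVlt => /andP[/orP[/eqP -> //|ij] jN].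
  by apply: ltW; apply: (cd_grow cd); rewrite ij.
(* If [s = 0] no height has to lie below, and [u] is 0. If [2 * s] reaches [n - 1], none has to lie
   above: [minn] then selects the last height, and [v] is [u + 1]. *)
pose u := if s == 0%N then 0 else w (minn (2 * s) n.-1).-1.
pose v := if (2 * s < n.-1)%N then w (2 * s)%N else u + 1.
exists u, v; split.
- by rewrite /u; case: eqP => // _; rewrite normr_ge0.
- rewrite /v; case: ltnP => h; last by rewrite ltrDl.
  rewrite /u; case: eqP => s0; last by apply: (cd_grow cd); lia.
  have iN : (2 * s < n.-1)%N by [].
  have := cd_sign cd iN; rewrite /w normr_gt0.
  by apply: contraTneq => ->; rewrite mulr0 ltxx.
- move=> i iN i2; rewrite /u; case: eqP => s0; first by lia.
  by apply: wmono; lia.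
- move=> i iN i2; rewrite /v (leq_ltn_trans i2 iN); apply: wmono; lia.
Qed.

(** Here [V ^ 2] is the future [T ^+ n], and [C * V] is the bound [Z] of the sieve; the hypothesis
    says that [V] is large. *)
Lemma interval_in_window (N C M c0 V : nat) (u v : rat) :
  0 <= u -> u < v -> (0 < M)%N -> (0 < V)%N ->
  (4 * N * C + 1 + c0)%N%:R <= (v - u) / (4%:R * M%:R) * V%:R ->
  exists X t0 : nat, [/\ (v - u) / (4%:R * M%:R) * (V ^ 2)%N%:R <= X%:R,
    (4 * N * (C * V) <= X)%N &
    forall t, (t0 <= t < t0 + X)%N ->
      [/\ (0 < t)%N, u * (V ^ 2)%N%:R < (c0 + M * t)%N%:R :> rat &
          (c0 + M * t)%N%:R < v * (V ^ 2)%N%:R :> rat] ].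
Proof.
move=> u0 uv M0 V0 BV; pose del := v - u; have del0 : 0 < del by rewrite subr_gt0.
have MQ : 0 < M%:R :> rat by rewrite ltr0n.
have VQ : 1 <= V%:R :> rat by rewrite ler1n.
pose W : rat := (V ^ 2)%N%:R; rewrite -/W -/del in BV *.
have WV : W = V%:R * V%:R by rewrite /W natrX expr2.
have W0 : 0 < W by rewrite /W ltr0n expn_gt0 V0.
set k1 : rat := del / (4%:R * M%:R) in BV *.
have k10 : 0 < k1 by rewrite divr_gt0 // mulr_gt0 // ltr0n.
set B : rat := (4 * N * C + 1 + c0)%N%:R in BV.
(* The values of [t] fill half of the available length [del * W / M]; the other half absorbs the
   shift by [c0]. *)
pose X := Num.truncn (del * W / (2%:R * M%:R)); pose t0 := (Num.truncn (u * W / M%:R)).+1.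
have uW0 : 0 <= u * W / M%:R by rewrite divr_ge0 ?ler0n // mulr_ge0 // ltW.
have dW0 : 0 <= del * W / (2%:R * M%:R) by rewrite divr_ge0 ?mulr_ge0 ?ler0n // ltW.
have k1E : del * W / (2%:R * M%:R) = 2%:R * k1 * V%:R * V%:R.
  by rewrite /k1 WV; field; rewrite gt_eqF.
have X_le : X%:R <= del * W / (2%:R * M%:R) by have /andP[] := truncn_itv dW0.
have X_gt : del * W / (2%:R * M%:R) - 1 < X%:R.
  by have /andP[_] := truncn_itv dW0; rewrite -natr1; lra.
clearbody X.
have BE : B = 4%:R * N%:R * C%:R + 1 + c0%:R by rewrite /B !natrD !natrM.
have B1 : 4%:R * N%:R * C%:R + 1 <= B by rewrite BE lerDl ler0n.
have NC0 : 0 <= 4%:R * N%:R * C%:R :> rat by rewrite !mulr_ge0 ?ler0n.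
have c00 : 0 <= c0%:R :> rat by rewrite ler0n.
have kVV : B * V%:R <= k1 * V%:R * V%:R by rewrite ler_wpM2r // ler0n.
have Xk : k1 * W <= X%:R.
have : 1 <= k1 * V%:R * V%:R.
    apply: le_trans kVV; rewrite -[1]mulr1 ler_pM //; lra.
  rewrite WV mulrA; lra.
have XZ : (4 * N * (C * V) <= X)%N.
  rewrite -(ler_nat rat) !natrM.
have h1 : (4%:R * N%:R * C%:R + 1) * V%:R <= k1 * V%:R * V%:R.
    by apply: le_trans kVV; rewrite ler_wpM2r ?ler0n.
  rewrite mulrDl mul1r in h1; rewrite mulrA.
have h2 : 0 <= 4%:R * N%:R * C%:R * V%:R :> rat by rewrite mulr_ge0 ?ler0n.
  lra.
exists X, t0; split=> // t /andP[tlo thi]; rewrite natrD natrM.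
have t_gt0 : (0 < t)%N by apply: leq_trans tlo.
have tlo' : u * W / M%:R < t%:R.
    have /andP[_ h] := truncn_itv uW0; apply: lt_le_trans h _; by rewrite ler_nat.
have thi' : t%:R <= u * W / M%:R + del * W / (2%:R * M%:R).
    have /andP[h _] := truncn_itv uW0; apply: le_trans (lerD h X_le).
    by rewrite -natrD ler_nat; move: thi; rewrite /t0 addSn ltnS.
split=> //.
  rewrite ltr_pdivrMr // mulrC in tlo'; lra.
have : M%:R * t%:R <= M%:R * (u * W / M%:R + del * W / (2%:R * M%:R)) by rewrite ler_pM2l.
have -> : M%:R * (u * W / M%:R + del * W / (2%:R * M%:R)) = u * W + del * W / 2%:R.
    by field; rewrite gt_eqF.
have : c0%:R < del * W / 2%:R.
    have -> : del * W / 2%:R = M%:R * (2%:R * k1 * V%:R * V%:R) by rewrite -k1E; field; rewrite gt_eqF.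
    have M1 : 1 <= M%:R :> rat by rewrite ler1n.
    have cB : c0%:R + 1 <= B * V%:R.
      rewrite -[c0%:R + 1]mulr1 ler_pM //; [lra|rewrite BE; lra].
    have : 1 * (2%:R * k1 * V%:R * V%:R) <= M%:R * (2%:R * k1 * V%:R * V%:R).
      by rewrite ler_wpM2r // -k1E.
    lra.
have -> : v * W = u * W + del * W by rewrite /del; ring.
  lra.
Qed.

(** In the proof [E ^ k] is [T ^+ n]. The window contains a positive proportion of [T ^+ n]
    parameters, half survive the sieve, and each discriminant arises at most [n - 1] times. *)
Lemma many_discs (n s : nat) (S : seq nat) :
  (1 < n)%N -> (2 * s <= n)%N -> all prime S ->
  exists (kappa : rat) (C E k0 : nat), [/\ 0 < kappa, (0 < C)%N, (1 < E)%N &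
    forall k, (k0 <= k)%N -> exists Ds : seq int,
      [/\ uniq Ds, kappa * (E ^ k)%:R <= (size Ds)%:R &
          forall d, d \in Ds -> (`|d| <= (C * E ^ k) ^ n.-1)%N /\
            exists P, good_poly n (n - 2 * s) S P /\ discC P = d%:~R]].
Proof.
move=> n1 sn Sp; have n0 : (0 < n)%N by apply: ltnW.
have [P [sp [al [be cd]]]] := critical_data_exists n1.
have [l pl nl] := prime_1mod n0; have [g pg] := Fp_prim_root pl.
set N := n.-1; have N0 : (0 < N)%N by rewrite /N -subn1 subn_gt0.
have l1 : (0 < l.-1)%N by rewrite -subn1 subn_gt0 prime_gt1.
have ln : ~~ (l %| n)%N.
  by apply/negP => /(dvdn_leq n0); have := dvdn_leq l1 nl; lia.
have g0 : g != 0.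
  apply/eqP => g0; have := prim_expr_order pg; rewrite g0 expr0n -[l.-1 == _]negbK -lt0n l1.
  by move/esym/eqP; rewrite oner_eq0.
pose y := (4 * N)%N.
have [D [c0 [/andP[D0 lD] Dn co c0g good]]] := bad_prime_modulus y n1 cd Sp pl ln g0.
have D1 : (1 < D)%N by apply: leq_trans (prime_gt1 pl) (dvdn_leq D0 lD).
pose M := (n * D)%N; have M0 : (0 < M)%N by rewrite muln_gt0 n0.
have MQ : 0 < M%:R :> rat by rewrite ltr0n.
have [u [v [u0 uv Hu Hv]]] := height_window s n1 cd.
pose del := v - u; have del0 : 0 < del by rewrite subr_gt0.
(* [C * T ^+ n] bounds every form as long as [c < v * T ^+ n]. *)
have [C Cy Cb] : exists2 C, (y < C)%N &
    forall i, (i < N)%N -> (al i)%:~R * v + `|be i|%:~R <= C%:R :> rat.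
  pose C := (y + \sum_(i < N) (absz (al i) * Num.bound v + absz (be i)) + 1)%N.
  exists C => [|i iN]; first by rewrite /C addn1 ltnS leq_addr.
  have : (absz (al i) * Num.bound v + absz (be i) <= C)%N.
    by rewrite /C (bigD1 (Ordinal iN)) //=; clear; lia.
  rewrite -(ler_nat rat) => h; apply: le_trans h; rewrite natrD natrM.
  have -> : `|be i|%:~R = (absz (be i))%:R :> rat by rewrite -abszE pmulrn.
  rewrite lerD2r; have -> : (al i)%:~R = (absz (al i))%:R :> rat.
    by rewrite [RHS]pmulrn abszE gtr0_norm ?(cd_pos cd).
  rewrite ler_wpM2l ?ler0n //; apply: ltW.
  by have := archi_boundP (ltW (le_lt_trans u0 uv)).
pose k1 : rat := del / (4%:R * M%:R).
have k10 : 0 < k1 by rewrite divr_gt0 // mulr_gt0 // ltr0n.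
pose B : rat := (4 * N * C + 1 + c0)%N%:R.
exists (k1 / (2 * N)%N%:R), C, (D ^ (2 * n))%N, (Num.bound (B / k1)).+1; split.
- by rewrite divr_gt0 // ltr0n muln_gt0.
- exact: leq_ltn_trans Cy.
- by apply: leq_trans D1 _; by rewrite -{1}(expn1 D) leq_pexp2l // muln_gt0.
(* The even exponent makes [T ^ n = V ^ 2] a square, so the forms are at most
   [C * V ^ 2 <= (C * V) ^ 2], as the sieve requires. A power of [D] has the same primes as [D]. *)
move=> k kk0; pose V := (D ^ (k * n))%N; pose T := (D ^ (2 * k))%N.
have k_gt0 : (0 < k)%N by apply: leq_trans kk0.
have V0 : (0 < V)%N by rewrite expn_gt0 D0.
have VQ : 1 <= V%:R :> rat by rewrite ler1n.
have TV : (T ^ n = V ^ 2)%N by rewrite /T /V -!expnM; congr (_ ^ _)%N; clear; lia.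
have EV : ((D ^ (2 * n)) ^ k = V ^ 2)%N by rewrite /V -!expnM; congr (_ ^ _)%N; clear; lia.
have kV : (k <= V)%N.
  apply: leq_trans (ltnW (ltn_expl k D1)) _; rewrite leq_pexp2l // leq_pmulr //.
(* The threshold on [k] exceeds [B / k1], and [k <= V]. *)
have BV : B <= k1 * V%:R.
  rewrite mulrC -ler_pdivrMr //; apply: le_trans (_ : k%:R <= _); last by rewrite ler_nat.
  have B0 : 0 <= B / k1 by rewrite divr_ge0 ?ler0n // ltW.
  apply: le_trans (ltW (archi_boundP B0)) _; by rewrite ler_nat ltnW.
rewrite EV; pose W : rat := (V ^ 2)%N%:R.
have WV : W = V%:R * V%:R by rewrite /W natrX expr2.
have W0 : 0 < W by rewrite /W ltr0n expn_gt0 V0.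
pose L i t : int := al i * (c0 + n * D * t)%N + T%:Z ^+ n * be i.
have TW : T%:Z%:~R ^+ n = W :> rat by rewrite -pmulrn -natrX TV.
have TD q : prime q -> (q %| T)%N = (q %| D)%N.
  by move=> pq; rewrite /T Euclid_dvdX // muln_gt0 k_gt0 /= andbT.
have [X [t0 [Xk XZ cbounds]]] := interval_in_window (N := N) (C := C) (c0 := c0) u0 uv M0 V0 BV.
have Lbound i t : (i < N)%N -> (t0 <= t < t0 + X)%N -> (absz (L i t) <= C * V ^ 2)%N.
  move=> iN /cbounds [_ c1 c2].
  rewrite -(ler_nat rat); have -> : (absz (L i t))%:R = `|L i t|%:~R :> rat by rewrite -abszE pmulrn.
  have -> : `|L i t|%:~R = `|(al i)%:~R * (c0 + M * t)%N%:R + W * (be i)%:~R| :> rat.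
    by rewrite intr_norm /L rmorphD !rmorphM rmorphXn /= TW -pmulrn.
  rewrite natrM -/W.
  have a0 : 0 < (al i)%:~R :> rat by rewrite ltr0z (cd_pos cd).
  apply: le_trans (ler_normD _ _) _.
  rewrite [`|(al i)%:~R * _|]ger0_norm ?mulr_ge0 ?ler0n ?(ltW a0) //.
  rewrite normrM (gtr0_norm W0) -intr_norm.
  apply: le_trans (_ : ((al i)%:~R * v + `|be i|%:~R) * W <= _); last first.
    by rewrite ler_wpM2r ?Cb // ltW.
  rewrite mulrDl -mulrA [W * _]mulrC lerD2r ler_wpM2l ?(ltW a0) //; exact: ltW.
have unit i t p : prime p -> (p %| M)%N -> (i < N)%N -> ~~ (p %| L i t)%Z.
  by move=> pp pM iN; apply: (form_unit n1 cd Dn co).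
have [|||||||||Dt [uDt sDt rDt sqDt]] := @squarefree_sieve N X t0 (C * V) y M L.
- by move=> p i t pp pM iN; apply: unit.
- by move=> p pp /(good p pp) [].
- by move=> p i t t' pp pM iN; move=> d1 d2; apply: (form_congruent cd pp pM iN d1 d2).
- move=> p i j t pp pM /andP[ij jN]; have [_ _ h] := good p pp pM.
  apply: form_coprime => //; last by apply: h; rewrite ?(ltn_trans ij jN) ?neq_ltn ?ij.
  by rewrite TD //; apply: contra pM => h'; rewrite dvdn_mull.
- move=> i t iN rt; split.
    apply/eqP => L0; have := unit i t l pl (dvdn_mull n lD) iN.
    by rewrite L0 dvdz0.
  by apply: leq_trans (Lbound i t iN rt) _; rewrite expnMn leq_mul2r -mulnn leq_pmulr ?orbT // (leq_ltn_trans _ Cy).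
- by [].
- by [].
- by apply: leq_trans (ltnW Cy) _; rewrite leq_pmulr.
- exact: XZ.
pose disc t : int := (-1) ^+ disc_sign n * \prod_(i < N) L i t.
exists (undup (map disc Dt)); split; first exact: undup_uniq.
- have h : (size Dt <= N * size (undup (map disc Dt)))%N.
    apply: size_le_fibers => d.
    pose a i := al i * M%:Z; pose b i := al i * c0%:Z + T%:Z ^+ n * be i.
    have a0 i : a i != 0 by rewrite mulf_neq0 ?lt0r_neq0 ?(cd_pos cd) // ltz_nat.
    apply: leq_trans (linear_product_fiber b ((-1) ^+ disc_sign n * d) N0 a0 uDt).
    apply: sub_count => t /= /eqP <-; apply/eqP; rewrite /disc mulrA -expr2 sqrr_sign mul1r.
    by apply: eq_bigr => i _; rewrite /a /b /L PoszD PoszM -/M; ring.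
  have h' : (X <= (2 * N) * size (undup (map disc Dt)))%N by apply: leq_trans sDt _; rewrite -mulnA leq_pmul2l.
  rewrite mulrAC ler_pdivrMr ?ltr0n ?muln_gt0 //.
  apply: le_trans Xk _; rewrite mulrC -natrM ler_nat //.
move=> d; rewrite mem_undup => /mapP[t tD ->]; have rt := rDt t tD; split.
  rewrite abszMsign (big_morph absz abszM (erefl _ : absz 1 = 1%N)).
  rewrite -[X in (_ <= _ ^ X)%N](card_ord N) -prod_nat_const; apply: leq_prod => i _.
  exact: Lbound.
have [t_gt0 c1 c2] := cbounds t rt.
exists (scale_poly n T%:Z P + (c0 + M * t)%N%:Z%:P).
apply: (@good_scale_poly n s S P sp al be l g) => //.
- by rewrite dvdzE /= TD.
- by rewrite ltz_nat expn_gt0 D0.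
- rewrite -pmulrn natrD c0g natrM (_ : M%:R = 0) ?mul0r ?addr0 //.
  by apply/eqP; rewrite -(dvdn_pcharf (pchar_Fp pl)) dvdn_mull.
- move=> i iN i2; rewrite TW -pmulrn; apply: le_lt_trans c1.
  by rewrite mulrC ler_wpM2r ?Hu // ltW.
- move=> i iN i2; rewrite TW -pmulrn; apply: lt_le_trans c2 _.
  by rewrite [X in _ <= X]mulrC ler_wpM2r ?Hv // ltW.
- by rewrite ltz_nat addn_gt0 muln_gt0 M0 t_gt0 orbT.
- exact: sqDt.
- move=> p pS; have pp := allP Sp p pS.
  have pM : (p %| M)%N by apply/negPn/negP => /(good p pp) [_]; rewrite pS.
  rewrite (big_morph absz abszM (erefl _ : absz 1 = 1%N)) Euclid_dvd_prod // big_orE.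
  by apply/existsPn => i /=; have := unit i t p pp pM (ltn_ord i); rewrite dvdzE.
Qed.

(** For given [N], the largest [k] with [(C E^k)^(n-1) <= N] is used: the root of [N] is then below
    [C E^(k+1)], hence within the constant factor [C E] of [E^k]. *)
Theorem theorem1p1 (n r s : nat) (S : seq nat) :
  (2 <= n)%N -> (r + 2 * s)%N = n -> all prime S ->
  (~ exists L : seq {poly int}, forall P, good_poly n r S P -> P \in L) /\
  (exists c : algC, 0 < c /\
     exists N0 : nat, forall N : nat, (N0 <= N)%N ->
       exists D : seq int,
         uniq D /\
         c * (n.-1).-root (N%:R : algC) <= (size D)%:R /\
         forall d, d \in D ->
           (`|d| <= N%:Z) /\
           exists P, good_poly n r S P /\ discC P = d%:~R).
Proof.
move=> n1 rs Sp.
have sn : (2 * s <= n)%N by rewrite -rs leq_addl.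
have -> : r = (n - 2 * s)%N by rewrite -rs addnK.
have [kap [C [E [k0 [kap0 C0 E1 HD]]]]] := many_discs n1 sn Sp.
have m0 : (0 < n.-1)%N by rewrite -subn1 subn_gt0.
split.
(* This [k] makes the number of distinct discriminants exceed the size of [L]. *)
- move=> [L HL]; pose k := maxn k0 (Num.bound ((size L)%:R / kap)).
  have [Ds [uDs szDs hDs]] := HD k (leq_maxl _ _).
  have sub : (size Ds <= size L)%N.
    rewrite -(size_map discC L) -(size_map (intr : int -> algC)).
    apply: uniq_leq_size; first by rewrite map_inj_uniq //; apply: intr_inj.
    by move=> _ /mapP[d /hDs[_ [P [gP <-]]] ->]; apply: map_f; apply: HL.
  have L0 : 0 <= (size L)%:R / kap by rewrite divr_ge0 ?ler0n // ltW.
  have : (size L)%:R < kap * (E ^ k)%:R.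
    rewrite mulrC -ltr_pdivrMr //; apply: lt_le_trans (archi_boundP L0) _.
    rewrite ler_nat; apply: leq_trans (leq_maxr k0 _) _; exact: ltnW (ltn_expl _ E1).
  by move=> /lt_le_trans /(_ szDs); rewrite ltr_nat ltnNge sub.
pose f k := ((C * E ^ k) ^ n.-1)%N.
have CE0 : 0 < (C * E)%N%:R :> rat by rewrite ltr0n muln_gt0 C0 ltnW.
exists (ratr (kap / (C * E)%N%:R)); split; first by rewrite ltr0q divr_gt0.
exists (f k0) => N fN.
have fk k : (f k <= N)%N -> (k <= N)%N.
  apply: leq_trans; apply: leq_trans (ltnW (ltn_expl k E1)) _.
  apply: (@leq_trans (C * E ^ k)%N); first by rewrite leq_pmull.
  by rewrite /f -{1}(expn1 (C * E ^ k)) leq_pexp2l // muln_gt0 C0 expn_gt0 ltnW.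
have [k fkN kmax] := ex_maxnP (ex_intro (fun k => f k <= N)%N k0 fN) fk.
have k0k : (k0 <= k)%N := kmax _ fN.
have [Ds [uDs szDs hDs]] := HD k k0k.
exists Ds; split=> //; split; last first.
  move=> d /hDs[dk Pd]; split=> //.
  by rewrite -abszE lez_nat; apply: leq_trans dk fkN.
have Nlt : (N < f k.+1)%N by rewrite ltnNge; apply/negP => /kmax; rewrite ltnn.
have rootN : (n.-1).-root (N%:R : algC) <= (C * E ^ k.+1)%N%:R.
  rewrite -[leRHS](exprCK m0) ?ler0n // ler_rootC ?qualifE /= ?ler0n ?exprn_ge0 ?ler0n //.
  by rewrite -natrX ler_nat ltnW.
apply: le_trans (ler_wpM2l _ rootN) _; first by rewrite ler0q ltW // divr_gt0.
rewrite -(ratr_nat _ (C * E ^ k.+1)) -rmorphM /= -(ratr_nat _ (size Ds)) ler_rat.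
apply: le_trans szDs; rewrite expnS mulnA (natrM _ (C * E)) mulrA divfK //.
by rewrite gt_eqF.
Qed.
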